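(* Let $\mathcal{B}$ be a Banach space, $U\subset\mathcal{B}$ an open set containing $\mathbf{0}$, and consider the discrete dynamical system $\mathbf{x}_{k+1}=\mathbf{f}(\mathbf{x}_k)=\mathbf{A}\mathbf{x}_k+\tilde{\mathbf{f}}(\mathbf{x}_k)$, where $\mathbf{A}:\mathcal{B}\to\mathcal{B}$ is an invertible bounded linear operator and $\tilde{\mathbf{f}}:U\to\mathcal{B}$ satisfies $\tilde{\mathbf{f}}(\mathbf{0})=\mathbf{0}$, $D\tilde{\mathbf{f}}(\mathbf{0})=\mathbf{0}$. Assume the following. (A1) For some $\alpha\in(0,1)$, the linear operator $\mathbf{A}$ is $\alpha$-contracting, i.e. $\rho(\mathbf{A})^{1+\alpha}\rho(\mathbf{A}^{-1})<1$ (and hence the fixed point $\mathbf{x}=\mathbf{0}$ is linearly stable). (A2) $\tilde{\mathbf{f}}\in C^{1,\alpha}(U)$ in the neighborhood $U$ of the origin. (A3) For some integer $d\in\mathbb{N}^+$, there is a splitting $\mathcal{B}=E\oplus F$ into two $\mathbf{A}$-invariant subspaces $E,F\subset\mathcal{B}$ such that $E$ is $d$-dimensional and slow, i.e. $$\rho(\mathbf{A}|_F)<\frac{1}{\rho(\mathbf{A}^{-1}|_E)} .$$ Furthermore, a $d$-dimensional observable function $\boldsymbol{\phi}\in C^2$ satisfies the non-degeneracy condition $\mathrm{rank}\,[D\boldsymbol{\phi}(\mathbf{0})|_E]=d$. (A4) The data matrices $\boldsymbol{\Phi}$ and $\hat{\boldsymbol{\Phi}}$ collected from iterations of the system are non-degenerate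 and are dominated by data near $E$, i.e. $$\mathrm{rank}_{\mathrm{row}}\,\boldsymbol{\Phi}=d,\qquad |\mathbf{P}_F\mathbf{X}|,\ |\mathbf{P}_F\hat{\mathbf{X}}|\le|\mathbf{P}_E\mathbf{X}|^{1+\beta}$$ for some $\beta\in(0,1)$. Then the DMD computed from $\boldsymbol{\Phi}$ and $\hat{\boldsymbol{\Phi}}$ yields a matrix $\boldsymbol{\mathcal{D}}$ that is locally topologically conjugate, with order $\mathcal{O}(|\mathbf{P}_E\mathbf{X}|^{\beta})$ error, to the linearized dynamics on a $d$-dimensional attracting spectral submanifold $\mathcal{W}(E)$ tangent to $E$ at $\mathbf{x}=\mathbf{0}$. Specifically, $$\boldsymbol{\mathcal{D}}=D\boldsymbol{\phi}(\mathbf{0})\mathbf{T}_E\,\boldsymbol{\Lambda}_E\left(D\boldsymbol{\phi}(\mathbf{0})\mathbf{T}_E\right)^{-1}+\mathcal{O}\left(|\mathbf{P}_E\mathbf{X}|^{\beta}\right).$$ The spectral submanifold $\mathcal{W}(E)$ and its reduced dynamics are of class $C^1$ in a neighborhood of the origin.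
   Context: Notation. The spectral radius of a bounded linear operator $\mathbf{A}$ is $\rho(\mathbf{A})=\lim_{k\to\infty}|\mathbf{A}^k|^{1/k}$. $\tilde{\mathbf{f}}\in C^{1,\alpha}(U)$ means that $\tilde{\mathbf{f}}$ is Fréchet differentiable in $U$ and its derivative $D\tilde{\mathbf{f}}$ is Hölder continuous in $U$ with exponent $\alpha$. $\mathbf{T}_E:\mathbb{R}^d\to E$ is the linear isomorphism given by a basis of $E$ consisting of the real and imaginary parts of the generalized eigenvectors of $\mathbf{A}|_E$, and $\boldsymbol{\Lambda}_E\in\mathbb{R}^{d\times d}$ is the matrix of $\mathbf{A}|_E$ in this basis, i.e. $\mathbf{A}\mathbf{T}_E=\mathbf{T}_E\boldsymbol{\Lambda}_E$. $\mathbf{P}_E$ and $\mathbf{P}_F$ denote the projections onto the $E$ and $F$ components in the splitting $\mathcal{B}=E\oplus F$ (with the $E$ component expressed in the coordinates of the basis of $E$ that defines $\mathbf{T}_E$). Data. $\mathbf{X}=[\mathbf{x}^1,\dots,\mathbf{x}^m]$ is an $m$-tuple of initial conditions in $U$, $\hat{\mathbf{X}}=\mathbf{f}(\mathbf{X})$, $\boldsymbol{\Phi}=\boldsymbol{\phi}(\mathbf{X})$ and $\hat{\boldsymbol{\Phi}}=\boldsymbol{\phi}(\mathbf{f}(\mathbf{X}))\in\mathbb{R}^{d\times m}$, where $\boldsymbol{\phi}$ takes values in $\mathbb{R}^d$ and all maps are applied entry by entry. $|\cdot|$ denotes the norm of the space in question (for finite matrices the Euclidean matrix norm; for $m$-tuples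 in $\mathcal{B}$ the corresponding product norm), and $\mathrm{rank}_{\mathrm{row}}$ is the row rank. DMD. The matrix $\boldsymbol{\mathcal{D}}\in\mathbb{R}^{d\times d}$ computed by dynamic mode decomposition (DMD) is the minimizer of $|\hat{\boldsymbol{\Phi}}-\boldsymbol{\mathcal{D}}\boldsymbol{\Phi}|^2$ given by $\boldsymbol{\mathcal{D}}=(\hat{\boldsymbol{\Phi}}\boldsymbol{\Phi}^{\mathrm{T}})(\boldsymbol{\Phi}\boldsymbol{\Phi}^{\mathrm{T}})^{\dagger}$, with $\dagger$ the pseudo-inverse. An attracting spectral submanifold $\mathcal{W}(E)$ is a $d$-dimensional invariant manifold through the fixed point, tangent to $E$ there, to which nearby trajectories converge exponentially. The $\mathcal{O}$ terms refer to the limit $|\mathbf{P}_E\mathbf{X}|\to0$ (data approaching the fixed point), with $\mathbf{f}$ and $\boldsymbol{\phi}$ fixed.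
   Formalization: The formal theorem assumes in addition that φ(0)=0 and β≤α, and lets the O-constant depend on an upper bound κ for |P_E X||Φ⁺| (Φ⁺ the pseudo-inverse of Φ); without each of these the claimed error bound is false. *)

(* Defs.v *)
From HB Require Import structures.
From mathcomp Require Export all_boot all_order all_algebra.
From mathcomp Require Export all_classical all_reals all_analysis.
Export numFieldNormedType.Exports.
Import Order.TTheory GRing.Theory Num.Theory.

Set Implicit Arguments.
Unset Strict Implicit.
Unset Printing Implicit Defensive.

Global Open Scope classical_set_scope.
Global Open Scope ring_scope.

Section Operators.
Context {R : realType}.

(* Norm of the restriction of [T] to the subset [S] of its domain. *)
Definition opnorm_on (V W : normedModType R) (S : set V) (T : V -> W) : R :=
  sup [set `|T x| | x in [set x | S x /\ `|x| <= 1]].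

Definition opnorm (V W : normedModType R) (T : V -> W) : R := opnorm_on setT T.

(* [rho(T|_S)], for a [T]-invariant subspace [S].  If [S] is trivial, this is
   0. *)
Definition spectral_radius_on (V : normedModType R) (S : set V) (T : V -> V) :
  R := lim ((opnorm_on S (iter k T)) `^ (k%:R^-1) @[k --> \oo]).

Definition spectral_radius (V : normedModType R) (T : V -> V) : R :=
  spectral_radius_on setT T.

Definition alpha_contracting (V : normedModType R) (alpha : R)
    (T Tinv : V -> V) : Prop :=
  spectral_radius T `^ (1 + alpha) * spectral_radius Tinv < 1.

End Operators.

Section Smoothness.
Context {R : realType} {V W : normedModType R}.

Definition C1_on (U : set V) (g : V -> W) : Prop :=
  (forall x, U x -> differentiable g x) /\
  (forall x, U x ->
     opnorm (fun v => 'd g y v - 'd g x v) @[y --> x] --> (0 : R)).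

Definition C1_holder_on (alpha : R) (U : set V) (g : V -> W) : Prop :=
  (forall x, U x -> differentiable g x) /\
  exists L : R, forall x y, U x -> U y ->
    opnorm (fun v => 'd g y v - 'd g x v) <= L * `|y - x| `^ alpha.

Definition bounded_bilinear (H : V -> V -> W) : Prop :=
  [/\ forall a u v w, H (a *: u + v) w = a *: H u w + H v w,
      forall a u v w, H w (a *: u + v) = a *: H w u + H w v
    & exists M : R, forall v w, `|H v w| <= M * `|v| * `|w|].

(* [H x] is the derivative at [x] of ['d g : V -> L(V, W)], where [L(V, W)]
   carries the operator norm and [L(V, L(V, W))] is identified with the space
   of bounded bilinear maps. *)
Definition C2_on (U : set V) (g : V -> W) : Prop :=
  C1_on U g /\
  exists H : V -> V -> V -> W,
    [/\ forall x, U x -> bounded_bilinear (H x),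
        forall x, U x -> forall e : R, 0 < e -> \forall y \near x,
          opnorm (fun v => 'd g y v - 'd g x v - H x (y - x) v)
            <= e * `|y - x|
      & forall x, U x -> forall e : R, 0 < e -> \forall y \near x,
          forall v w, `|H y v w - H x v w| <= e * `|v| * `|w|].

End Smoothness.

Section Splitting.
Context {R : realType} {B : normedModType R}.

Definition is_subspace (S : set B) : Prop :=
  S 0 /\ forall (a : R) x y, S x -> S y -> S (a *: x + y).

Definition is_direct_sum (E F : set B) : Prop :=
  [/\ is_subspace E, is_subspace F, E `&` F = [set 0]
    & forall x, exists e f, [/\ E e, F f & x = e + f]].

Definition invariant_under (T : B -> B) (S : set B) : Prop :=
  forall x, S x -> S (T x).

(* [u + i v] is a generalized eigenvector of the complexification of [A|_E]
   for the eigenvalue [a + i b]; pairs stand for elements of [E + i E], and the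
   iterated map is [A - (a + i b)]. *)
Definition generalized_eigenvector (A : B -> B) (E : set B) (u v : B) : Prop :=
  [/\ E u, E v, (u, v) <> (0, 0) & exists (a b : R) (k : nat),
    iter k (fun p : B * B => (A p.1 - a *: p.1 + b *: p.2,
                              A p.2 - a *: p.2 - b *: p.1)) (u, v) = (0, 0)].

(* [T] is the isomorphism [R^d -> E] given by a basis of [E] consisting of real
   and imaginary parts of generalized eigenvectors of [A|_E]; in particular
   [E] is [d]-dimensional. *)
Definition real_eigenbasis_iso (A : B -> B) (E : set B) (d : nat)
    (T : {linear 'cV[R]_d -> B}) : Prop :=
  [/\ injective T, range T = E
    & forall j : 'I_d, exists u v, generalized_eigenvector A E u v /\
        (T (delta_mx j 0) = u \/ T (delta_mx j 0) = v)].

(* The [E] component is expressed in the coordinates given by [T]. *)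
Definition splitting_projections (F : set B) (d : nat)
    (T : {linear 'cV[R]_d -> B}) (PE : B -> 'cV[R]_d) (PF : B -> B) : Prop :=
  forall x, F (PF x) /\ x = T (PE x) + PF x.

End Splitting.

Section Data.
Context {R : realType}.

(* The library norm on matrices is the maximum norm. *)
Definition euclid_norm (m n : nat) (M : 'M[R]_(m, n)) : R :=
  Num.sqrt (\sum_i \sum_j M i j ^+ 2).

Definition tuple_norm (V : normedModType R) (m : nat) (X : 'I_m -> V) : R :=
  Num.sqrt (\sum_i `|X i| ^+ 2).

Definition data_matrix (T : Type) (d m : nat) (phi : T -> 'cV[R]_d)
    (X : 'I_m -> T) : 'M[R]_(d, m) :=
  \matrix_(i, j) phi (X j) i 0.

Definition is_moore_penrose (m n : nat) (M : 'M[R]_(m, n))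
    (P : 'M[R]_(n, m)) : Prop :=
  [/\ M *m P *m M = M, P *m M *m P = P,
      (M *m P)^T = M *m P & (P *m M)^T = P *m M].

Definition pseudo_inverse (m n : nat) (M : 'M[R]_(m, n)) : 'M[R]_(n, m) :=
  xget 0 [set P | is_moore_penrose M P].

Definition dmd (d m : nat) (Phi Phihat : 'M[R]_(d, m)) : 'M[R]_d :=
  (Phihat *m Phi^T) *m pseudo_inverse (Phi *m Phi^T).

(* Matrix of [D phi (0) T]; its rank is that of [D phi (0)] on the range of
   [T]. *)
Definition observable_jacobian (B : normedModType R) (d : nat)
    (phi : B -> 'cV[R]_d) (T : 'cV[R]_d -> B) : 'M[R]_d :=
  \matrix_(i, j) ('d phi (0 : B) (T (delta_mx j 0))) i 0.

End Data.

Section Manifolds.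
Context {R : realType} {B : normedModType R}.

Definition dist_to (W : set B) (x : B) : R := inf [set `|x - y| | y in W].

(* [W] is a local [d]-dimensional embedded C^1 submanifold, given by the chart
   [w : Omega -> W]; [r] is the dynamics of [f] on [W] read in this chart.
   As [f] only matters on [U], trajectories are required to remain in [U]. *)
Record attracting_ssm (U : set B) (f : B -> B) (E : set B) (d : nat)
    (W : set B) (Omega : set 'cV[R]_d) (w : 'cV[R]_d -> B)
    (r : 'cV[R]_d -> 'cV[R]_d) : Prop := AttractingSSM {
  ssm_domain : open Omega /\ Omega 0 ;
  ssm_image : w @` Omega = W /\ W `<=` U ;
  ssm_C1 : C1_on Omega w ;
  ssm_immersion : forall z, Omega z -> injective ('d w z) ;
  ssm_embedding : exists winv : B -> 'cV[R]_d,
    (forall z, Omega z -> winv (w z) = z) /\ {within W, continuous winv} ;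
  ssm_fixed_point : w 0 = 0 ;
  ssm_tangent : range ('d w (0 : 'cV[R]_d)) = E ;
  ssm_invariant : forall z, Omega z -> Omega (r z) /\ f (w z) = w (r z) ;
  ssm_reduced_C1 : C1_on Omega r ;
  ssm_attracting : exists (N : set B) (K q : R),
    [/\ nbhs (0 : B) N, 0 <= q < 1 & forall x, N x -> forall n : nat,
      U (iter n f x) /\
      dist_to W (iter n f x) <= K * q ^+ n * dist_to W x] }.

(* Local conjugacy near the common fixed point 0. *)
Definition locally_top_conjugate (d : nat) (g1 g2 : 'cV[R]_d -> 'cV[R]_d) :
    Prop :=
  exists (N : set 'cV[R]_d) (h hinv : 'cV[R]_d -> 'cV[R]_d),
    [/\ open N /\ N 0, open (h @` N) /\ h 0 = 0,
        (forall z, N z -> hinv (h z) = z),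
        (forall z, N z -> {for z, continuous h}) /\
        (forall y, (h @` N) y -> {for y, continuous hinv})
      & forall z, N z -> N (g1 z) -> h (g1 z) = g2 (h z)].

End Manifolds.

(* Main.v *)
(** Since [rho(A)^(1+alpha) rho(A^-1) < 1], the maps [A^-n f^n] converge near 0
    to a local C^1 diffeomorphism [h] with [h(0) = 0], [Dh(0) = id] and
    [h f = A h]: the increment [A^-(n+1) (ft (f^n x))] and its Lipschitz constant
    decay geometrically, with ratio close to [rho(A)^(1+alpha) rho(A^-1)].  Hence
    [h^-1(E)] is the spectral submanifold, in the chart [h^-1 TE] the dynamics
    on it is exactly the linear map [LE], and it attracts because [A] contracts.

    For DMD, [Phi] has full row rank, so [D - M0 = (Phihat - M0 Phi) Phi^+], and
    a Taylor expansion bounds the column of [Phihat - M0 Phi] coming from [x] by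
    [C (|PF x| + |PF (f x)| + |x|^(1+alpha))]. *)

From HB Require Import structures.
Require Import Defs.
Import Order.TTheory GRing.Theory Num.Theory.
From mathcomp Require Import ring lra.

Set Implicit Arguments.
Unset Strict Implicit.
Unset Printing Implicit Defensive.

(** * Strict differentiability *)

(** The spectral radii are asymptotic rates, whereas convergence needs one-step bounds. Norms
    adapted to [A] and to [Ainv] turn the rates into constants [a0 < a] and [b], and the gap
    [a - a0] absorbs the nonlinearity near 0. The exponent [alpha] is gained because orbits shrink:
    at time [n] they lie in a ball of radius [a ^+ n * s], where the Lipschitz constant of [ft] is
    at most [K] times that radius to the power [alpha]. The factor [s] to the power [alpha] survives
    in the limit and makes [h] as close to the identity as desired on small balls; this gives both
    [Dh(0) = id] and the local inverse.

    In the DMD estimate the residual [Phihat - M0 Phi] is of order [PEX^(1 + beta)]: the bounds on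
    the [PF] components give this directly, and [beta <= alpha] gives it for the Taylor terms. The
    pseudo-inverse may be as large as [kappa / PEX], which costs one power of [PEX] and leaves
    [PEX^beta]. *)

Section StrictDifferentiability.
Context {R : realType}.
Implicit Types V W X : normedModType R.

(** A predicate on plain functions, so that limits of operators and inverses obtained by choice need
    not be packed first. *)
Definition bounded_linear V W (L : V -> W) : Prop :=
  linear L /\ exists2 M : R, 0 <= M & forall v, `|L v| <= M * `|v|.

(* On an open set this is equivalent to C^1, but unlike C^1 it passes directly
   to compositions, to inverses and to limits in the Lipschitz seminorm, so the
   derivatives of [A^-n f^n] never have to be handled. *)
Definition strict_diff V W (g : V -> W) (x : V) (L : V -> W) : Prop :=
  bounded_linear L /\ forall e : R, 0 < e -> exists2 delta : R, 0 < delta &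
    forall y z, `|y - x| < delta -> `|z - x| < delta ->
      `|g y - g z - L (y - z)| <= e * `|y - z|.

Lemma bounded_linear0 V W (L : V -> W) : bounded_linear L -> L 0 = 0.
Proof.
move=> [_ [M _ LM]]; apply/normr0_eq0/eqP; rewrite eq_le normr_ge0 andbT.
by have := LM 0; rewrite normr0 mulr0.
Qed.

Lemma bounded_linearD V W (L : V -> W) u v : bounded_linear L -> L (u + v) = L u + L v.
Proof. by move=> [LL _]; have := LL 1 u v; rewrite !scale1r. Qed.

Lemma bounded_linearZ V W (L : V -> W) a v : bounded_linear L -> L (a *: v) = a *: L v.
Proof.
by move=> bL; have := bL.1 a v 0; rewrite !addr0 (bounded_linear0 bL) addr0.
Qed.

Lemma bounded_linearB V W (L : V -> W) u v : bounded_linear L -> L (u - v) = L u - L v.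
Proof.
by move=> bL; rewrite bounded_linearD// -scaleN1r bounded_linearZ// scaleN1r.
Qed.

Lemma continuous_bounded_linear V W (L : {linear V -> W}) :
  continuous L -> bounded_linear L.
Proof.
move=> cL; split; first exact: linearP.
have /linear_boundedP/pinfty_ex_gt0[M M0 LM] :=
  continuous_linear_bounded 0 (cL 0).
by exists M => //; exact: ltW.
Qed.

Lemma bounded_linear_pack V W (L : V -> W) : bounded_linear L ->
  exists2 T : {linear V -> W}, continuous T & T = L :> (V -> W).
Proof.
move=> [linL [M M0 LM]].
pose HL := GRing.isLinear.Build R V W _ L linL.
pose T : {linear V -> W} := HB.pack L HL.
exists T => //; apply: bounded_linear_continuous; apply/linear_boundedP.
exists M; split => [|r Mr v]; first exact: ger0_real.
by apply: le_trans (LM v) _; apply: ler_wpM2r => //; exact: ltW.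
Qed.

Lemma bounded_linear_comp V W X (L : V -> W) (L' : W -> X) :
  bounded_linear L -> bounded_linear L' -> bounded_linear (L' \o L).
Proof.
move=> [LL [M M0 LM]] [LL' [M' M'0 LM']]; split.
  by move=> a u v /=; rewrite LL LL'.
exists (M' * M); first exact: mulr_ge0.
move=> v /=; rewrite (le_trans (LM' _))// -mulrA ler_wpM2l//.
Qed.

Lemma bounded_linear_add V W (L L' : V -> W) :
  bounded_linear L -> bounded_linear L' ->
  bounded_linear (fun v => L v + L' v).
Proof.
move=> [LL [M M0 LM]] [LL' [M' M'0 LM']]; split.
  by move=> a u v /=; rewrite LL LL' scalerDr addrACA.
exists (M + M'); first exact: addr_ge0.
by move=> v /=; rewrite (le_trans (ler_normD _ _))// mulrDl lerD.
Qed.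

Lemma strict_diff_linear V W (L : V -> W) x :
  bounded_linear L -> strict_diff L x L.
Proof.
move=> bL; split => // e e0; exists 1 => // y z _ _.
by rewrite bounded_linearB// subrr normr0 mulr_ge0// ltW.
Qed.

Lemma strict_diff_lip V W (g : V -> W) x L : strict_diff g x L ->
  exists M delta : R, [/\ 0 < M, 0 < delta & forall y z,
    `|y - x| < delta -> `|z - x| < delta -> `|g y - g z| <= M * `|y - z|].
Proof.
move=> [[_ [M M0 LM]] /(_ 1 ltr01)[delta d0 gd]]; exists (M + 1), delta.
split => //; first by rewrite ltr_wpDl.
move=> y z yx zx; rewrite -[g y - g z](subrK (L (y - z))).
by rewrite (le_trans (ler_normD _ _))// addrC mulrDl lerD ?gd.
Qed.

Lemma strict_diff_comp V W X (f : V -> W) (g : W -> X) x L L' :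
  strict_diff f x L -> strict_diff g (f x) L' ->
  strict_diff (g \o f) x (L' \o L).
Proof.
move=> sf sg; have [M [d1 [M0 d10 fM]]] := strict_diff_lip sf.
case: sf sg => bL fL [bL' gL']; split; first exact: bounded_linear_comp.
move=> e e0; have [_ [K K0 LK]] := bL'.
have [] := gL' (e / 2 / M); first by rewrite !divr_gt0.
move=> d2 d20 gd; have [] := fL (e / 2 / (K + 1)).
  by rewrite !divr_gt0// ltr_wpDl.
move=> d3 d30 fd.
have xd1 : `|x - x| < d1 by rewrite subrr normr0.
exists (Num.min d1 (Num.min d3 (d2 / M))).
  by rewrite !lt_min d10 d30/= divr_gt0.
move=> y z; rewrite !lt_min => /and3P[y1 y3 y2] /and3P[z1 z3 z2] /=.
have fx u : `|u - x| < d1 -> `|u - x| < d2 / M -> `|f u - f x| < d2.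
  by move=> u1 u2; rewrite (le_lt_trans (fM _ _ u1 xd1))// mulrC -ltr_pdivlMr.
have -> : g (f y) - g (f z) - L' (L (y - z)) =
    (g (f y) - g (f z) - L' (f y - f z)) + L' (f y - f z - L (y - z)).
  by rewrite [L' (_ - L _)]bounded_linearB// addrA subrK.
rewrite (le_trans (ler_normD _ _))// [e in leRHS]splitr mulrDl lerD//.
  rewrite (le_trans (gd _ _ (fx _ y1 y2) (fx _ z1 z2)))//.
  rewrite -mulrA ler_pM2l ?divr_gt0// mulrC ler_pdivrMr// mulrC.
  exact: fM.
rewrite (le_trans (LK _))//.
rewrite (le_trans (ler_wpM2l K0 (fd _ _ y3 z3)))//.
rewrite mulrA ler_wpM2r// mulrCA -[leRHS]mulr1 ler_pM2l ?divr_gt0//.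
by rewrite ler_pdivrMr ?mul1r ?lerDl// ltr_wpDl.
Qed.

Lemma strict_diff_add V W (f g : V -> W) x L L' :
  strict_diff f x L -> strict_diff g x L' ->
  strict_diff (fun u => f u + g u) x (fun v => L v + L' v).
Proof.
move=> [bL fL] [bL' gL']; split; first exact: bounded_linear_add.
move=> e e0; have e20 : 0 < e / 2 by rewrite divr_gt0.
have [d1 d10 fd] := fL _ e20; have [d2 d20 gd] := gL' _ e20.
exists (Num.min d1 d2); first by rewrite lt_min d10.
move=> y z; rewrite !lt_min => /andP[y1 y2] /andP[z1 z2] /=.
have -> : f y + g y - (f z + g z) - (L (y - z) + L' (y - z)) =
    (f y - f z - L (y - z)) + (g y - g z - L' (y - z)).
  by rewrite [RHS]addrACA -opprD [f y - f z + _]addrACA -opprD.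
rewrite (le_trans (ler_normD _ _))//.
by rewrite [e in leRHS]splitr mulrDl lerD ?fd ?gd.
Qed.

Lemma strict_diff_ball V W (g : V -> W) x L e : strict_diff g x L -> 0 < e ->
  exists2 delta : R, 0 < delta & forall v, `|v| < delta ->
    `|g (x + v) - g x - L v| <= e * `|v|.
Proof.
move=> [_ /[apply]] [d d0 gd]; exists d => // v vd.
have := gd (x + v) x; rewrite subrr normr0 [x + v]addrC addrK; exact.
Qed.

Lemma differentiable_ball V W (g : V -> W) x e : differentiable g x -> 0 < e ->
  exists2 delta : R, 0 < delta & forall v, `|v| < delta ->
    `|g (x + v) - g x - 'd g x v| <= e * `|v|.
Proof.
move=> /diff_locally /eqaddoP gx e0.
have /nbhs_norm0P[d /= d0 gd] := gx _ e0.
exists d => // v vd; have := gd v vd; rewrite /= /cst !fctE/=.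
by rewrite [v + x]addrC opprD addrA.
Qed.

Lemma strict_diff_differentiable V W (g : V -> W) x L :
  strict_diff g x L -> differentiable g x /\ 'd g x = L :> (V -> W).
Proof.
move=> sg; have [T cT TL] := bounded_linear_pack sg.1.
have Tdiff : g \o shift x = cst (g x) + T +o_ 0 id.
  apply/eqaddoP => e e0.
  have [d d0 gd] := strict_diff_ball sg e0.
  apply/nbhs_norm0P; exists d => // v /= vd.
  have := gd v vd; rewrite [x + v]addrC -addrA -opprD -TL; exact.
have dT := diff_unique cT Tdiff; rewrite -TL; split => //.
by apply/diff_locallyP; rewrite dT.
Qed.

(** Both hypotheses concern small [v] only, but by linearity any [v] can be scaled to norm below
    [delta], compared there and scaled back. This replaces uniqueness of the derivative where only
    approximate tangents are at hand. *)
Lemma tangent_dist V W (g : V -> W) x (L L' : V -> W) (k k' delta : R) :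
  bounded_linear L -> bounded_linear L' -> 0 < delta ->
  (forall v, `|v| < delta -> `|g (x + v) - g x - L v| <= k * `|v|) ->
  (forall v, `|v| < delta -> `|g (x + v) - g x - L' v| <= k' * `|v|) ->
  forall v, `|L v - L' v| <= (k + k') * `|v|.
Proof.
move=> bL bL' d0 gL gL' v; have [->|v0] := eqVneq v 0.
  by rewrite (bounded_linear0 bL) (bounded_linear0 bL') subrr !normr0 mulr0.
have nv0 : 0 < `|v| by rewrite normr_gt0.
pose t := delta / 2 / `|v|; have t0 : 0 < t by rewrite !divr_gt0.
have tv : `|t *: v| < delta.
  rewrite normrZ gtr0_norm// divfK ?gt_eqF//.
  by rewrite ltr_pdivrMr// ltr_pMr// ltr1n.
have A := gL _ tv; have A' := gL' _ tv.
rewrite (bounded_linearZ _ _ bL) in A; rewrite (bounded_linearZ _ _ bL') in A'.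
rewrite -(ler_pM2l t0) mulrCA -[t in X in X <= _](gtr0_norm t0) -normrZ.
rewrite -[t in X in _ <= X](gtr0_norm t0) -normrZ mulrDl scalerBr.
have -> : t *: L v - t *: L' v = (g (x + t *: v) - g x - t *: L' v) -
    (g (x + t *: v) - g x - t *: L v).
  by rewrite opprB [RHS]addrC subrKA.
by rewrite (le_trans (ler_normB _ _))// addrC lerD.
Qed.

End StrictDifferentiability.

(** * The mean value inequality in normed spaces *)

Section MeanValue.
Context {R : realType}.
Implicit Types V W : normedModType R.

(** The bound with slope [M + e] is propagated along [[0, 1]]: the supremum of the times at which it
    holds satisfies it too, and the local estimate there would push it further unless it is 1. *)
Lemma mean_value_path W (gam : R -> W) (M : R) :
  (forall t, 0 <= t <= 1 -> forall e, 0 < e -> exists2 delta, 0 < delta &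
     forall s, 0 <= s <= 1 -> `|s - t| < delta ->
       `|gam s - gam t| <= (M + e) * `|s - t|) ->
  `|gam 1 - gam 0| <= M.
Proof.
move=> loc; apply/ler_addgt0Pr => e e0.
pose S := [set t : R | 0 <= t <= 1 /\ `|gam t - gam 0| <= (M + e) * t].
have S0 : S 0 by rewrite /S /= subrr normr0 mulr0 lexx ler01.
have hS : has_sup S by split; [exists 0|exists 1 => t [/andP[]]].
have c01 : 0 <= sup S <= 1.
  by rewrite ub_le_sup//= ?ge_sup//; [exists 0|move=> t [/andP[]]|case: hS].
have [d d0 locd] := loc _ c01 _ e0; set c := sup S in c01 locd *.
have Sc : S c.
  have [s Ss cs] := sup_adherent d0 hS.
  have sc : s <= c by apply: ub_le_sup => //; case: hS.
  have [s01 gs] := Ss.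
  have cs' : `|s - c| < d by rewrite distrC ger0_norm ?subr_ge0// ltrBlDl -ltrBlDr.
  split => //; rewrite -(subrK (gam s) (gam c)) -addrA.
  rewrite (le_trans (ler_normD _ _))// distrC.
  rewrite (le_trans (lerD (locd _ s01 cs') gs))//.
  by rewrite distrC ger0_norm ?subr_ge0// -mulrDr subrK.
have [c1|c1] := leP 1 c.
  by have : c = 1 by [lra]; move=> cE; have [_] := Sc; rewrite cE mulr1.
have [cge0 _] := andP c01.
pose s := Num.min 1 (c + d / 2).
have cs : c < s by rewrite lt_min c1 ltrDl divr_gt0.
have s01 : 0 <= s <= 1 by rewrite ge_min lexx andbT (le_trans _ (ltW cs)).
have sd : `|s - c| < d.
  rewrite ger0_norm ?subr_ge0 ?(ltW cs)// ltrBlDl (@le_lt_trans _ _ (c + d / 2))//.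
    by rewrite ge_min lexx orbT.
  by rewrite ltrD2l ltr_pdivrMr// ltr_pMr// ltr1n.
suff /(ub_le_sup hS.2) : S s by rewrite leNgt cs.
split => //; rewrite -(subrK (gam c) (gam s)) -addrA.
rewrite (le_trans (ler_normD _ _))//.
rewrite (le_trans (lerD (locd _ s01 sd) Sc.2))//.
by rewrite ger0_norm ?subr_ge0 ?(ltW cs)// -mulrDr subrK.
Qed.

Lemma mean_value_ineq V W (g : V -> W) (y z : V) (M : R) :
  (forall t, 0 <= t <= 1 -> differentiable g (z + t *: (y - z)) /\
    `|'d g (z + t *: (y - z)) (y - z)| <= M) ->
  `|g y - g z| <= M.
Proof.
move=> hg; have [->|yz] := eqVneq y z.
  rewrite subrr normr0; have [] := hg 0; first by rewrite lexx ler01.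
  by move=> _; exact: le_trans.
have yz0 : 0 < `|y - z| by rewrite normr_gt0 subr_eq0.
have := @mean_value_path _ (fun t => g (z + t *: (y - z))) M.
rewrite scale1r scale0r addr0 addrCA subrr addr0; apply=> t t01 e e0.
have [dg gM] := hg t t01.
have [|d d0 gd] := differentiable_ball (e := e / `|y - z|) dg.
  by rewrite divr_gt0.
exists (d / `|y - z|) => [|s s01]; first by rewrite divr_gt0.
rewrite ltr_pdivlMr// => sd.
have := gd ((s - t) *: (y - z)); rewrite normrZ => /(_ sd).
have -> : z + t *: (y - z) + (s - t) *: (y - z) = z + s *: (y - z).
  by rewrite -addrA -scalerDl addrCA subrr addr0.
rewrite linearZ/= => gs.
rewrite -[X in `|X|](subrK ((s - t) *: 'd g (z + t *: (y - z)) (y - z))).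
rewrite (le_trans (ler_normD _ _))// addrC mulrDl lerD//.
  by rewrite normrZ mulrC ler_wpM2r.
by rewrite (le_trans gs)// mulrA mulrAC divfK ?gt_eqF.
Qed.

Lemma opnorm_le V W (L : V -> W) (M : R) : bounded_linear L ->
  opnorm L <= M -> forall v, `|L v| <= M * `|v|.
Proof.
move=> bL LM v; have [->|v0] := eqVneq v 0.
  by rewrite bounded_linear0// !normr0 mulr0.
have nv0 : 0 < `|v| by rewrite normr_gt0.
rewrite -ler_pdivrMr// (le_trans _ LM)//.
apply: ub_le_sup.
  have [_ [K K0 LK]] := bL; exists K => _ [w [_ w1] <-].
  by rewrite (le_trans (LK _))// -[leRHS]mulr1 ler_wpM2l.
exists (`|v|^-1 *: v).
  by split => //; rewrite normrZ gtr0_norm ?invr_gt0// mulVf ?gt_eqF.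
by rewrite bounded_linearZ// normrZ gtr0_norm ?invr_gt0// mulrC.
Qed.

Lemma opnorm_ge0 V W (L : V -> W) : 0 <= opnorm L.
Proof.
rewrite /opnorm /opnorm_on; set S := [set _ | _ in _].
(* An unbounded set of values has [sup] equal to 0 by convention, so the claim holds for every
   function. *)
have [hS|] := pselect (has_sup S); last by move=> /sup_out ->.
have SL : S `|L 0| by exists 0 => //; split=> //; rewrite normr0.
by apply: le_trans (ub_le_sup hS.2 SL).
Qed.

Lemma opnorm_ub V W (L : V -> W) (M : R) : 0 <= M ->
  (forall v, `|L v| <= M * `|v|) -> opnorm L <= M.
Proof.
move=> M0 LM; apply: ge_sup.
  by exists `|L 0|, 0 => //; split=> //; rewrite normr0.
by move=> _ [v [_ v1] <-]; rewrite (le_trans (LM _))// -[leRHS]mulr1 ler_wpM2l.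
Qed.

Lemma diff_bounded_linear V W (g : V -> W) x :
  differentiable g x -> bounded_linear ('d g x).
Proof. by move=> dg; apply: continuous_bounded_linear; exact: diff_continuous. Qed.

Lemma bounded_linear_sub V W (L L' : V -> W) :
  bounded_linear L -> bounded_linear L' ->
  bounded_linear (fun v => L v - L' v).
Proof.
move=> bL [LL' [M M0 LM]]; apply: bounded_linear_add => //; split.
  by move=> a u v; rewrite LL' opprD scalerN.
by exists M => // v; rewrite normrN.
Qed.

Lemma mean_value_sub V W (g : V -> W) (L : V -> W) (y z : V) (M : R) :
  bounded_linear L ->
  (forall t, 0 <= t <= 1 -> differentiable g (z + t *: (y - z)) /\
    `|'d g (z + t *: (y - z)) (y - z) - L (y - z)| <= M) ->
  `|g y - g z - L (y - z)| <= M.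
Proof.
move=> bL hg; have [T cT TL] := bounded_linear_pack bL; rewrite -TL in hg *.
have -> : g y - g z - T (y - z) = (g - (T : V -> W)) y - (g - (T : V -> W)) z.
  rewrite linearB -[(g - _) y]/(g y - T y) -[(g - _) z]/(g z - T z).
  by rewrite !opprD !opprK addrACA.
apply: mean_value_ineq => t t01; have [dg gM] := hg t t01.
have dT := linear_differentiable (z + t *: (y - z)) cT.
split; first exact: differentiableB.
by rewrite diffB//= (diff_lin _ cT).
Qed.

Lemma ball_segment V (x y z : V) (r t : R) : `|y - x| < r -> `|z - x| < r ->
  0 <= t <= 1 -> `|z + t *: (y - z) - x| < r.
Proof.
move=> yx zx /andP[t0 t1].
have -> : z + t *: (y - z) - x = (1 - t) *: (z - x) + t *: (y - x).
  rewrite (_ : y - z = (y - x) - (z - x)); last by rewrite opprB addrA subrK.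
  by rewrite scalerBr addrAC [t *: _ - _]addrC addrA scalerBl scale1r.
rewrite (le_lt_trans (ler_normD _ _))// !normrZ !ger0_norm ?subr_ge0//.
have [tt|tt] := leP t 0.
  have -> : t = 0 by lra.
  by rewrite subr0 mul1r mul0r addr0.
have : t * `|y - x| < t * r by rewrite ltr_pM2l.
have : (1 - t) * `|z - x| <= (1 - t) * r by rewrite ler_wpM2l ?subr_ge0// ltW.
lra.
Qed.

End MeanValue.

Section Smooth.
Context {R : realType}.
Implicit Types V W : normedModType R.

(** The strict estimate at [x] concerns pairs of points, so it also says that [L] is an approximate
    tangent at each nearby [y], on a smaller ball around [y]. Comparing [L] with the derivative at
    [y] gives continuity of the derivative. *)
Lemma strict_diff_near V W (g : V -> W) (U : set V) x L (e : R) :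
  (forall y, U y -> exists L', strict_diff g y L') -> strict_diff g x L ->
  0 < e -> exists2 delta : R, 0 < delta & forall y, U y -> `|y - x| < delta ->
    forall v, `|'d g y v - L v| <= e * `|v|.
Proof.
move=> gU [bL gL] e0; have [d d0 gd] := gL _ (divr_gt0 e0 (ltr0Sn _ 1)).
exists d => // y Uy yx; have [L' gL'] := gU _ Uy.
have [_ ->] := strict_diff_differentiable gL'.
have [d' d'0 gd'] := strict_diff_ball gL' (divr_gt0 e0 (ltr0Sn _ 1)).
have m0 : 0 < Num.min d' (d - `|y - x|) by rewrite lt_min d'0 subr_gt0.
rewrite [e]splitr; apply: (tangent_dist gL'.1 bL m0) => v; rewrite lt_min.
  by move=> /andP[vd _]; exact: gd'.
move=> /andP[_ vd]; have := gd (y + v) y _ yx.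
rewrite [y + v - y]addrAC subrr add0r; apply.
rewrite (_ : y + v - x = v + (y - x)); last by rewrite [y + _]addrC addrA.
by rewrite (le_lt_trans (ler_normD _ _))// -ltrBrDr.
Qed.

Lemma strict_diff_C1 V W (g : V -> W) (U : set V) : open U ->
  (forall y, U y -> exists L, strict_diff g y L) -> C1_on U g.
Proof.
move=> oU gU; split=> x Ux; have [L gL] := gU _ Ux;
  have [dg dgL] := strict_diff_differentiable gL => //.
apply/cvgrPdist_le => e e0.
have [d d0 gd] := strict_diff_near gU gL e0.
have Ux' : nbhs x U by exact: open_nbhs_nbhs.
near=> y; rewrite sub0r normrN ger0_norm ?opnorm_ge0// opnorm_ub ?ltW//.
move=> v; rewrite dgL; apply: gd; first by near: y.
rewrite distrC; near: y.
by apply/nbhs_normP; exists d.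
Unshelve. all: by end_near. Qed.

End Smooth.

(** * Consequences of completeness: limits, fixed points, differentiable limits *)

Section Complete.
Context {R : realType}.

Lemma geometric_limit (V : completeNormedModType R) (u : nat -> V) (M q : R) :
  0 <= M -> 0 <= q < 1 -> (forall n, `|u n.+1 - u n| <= M * q ^+ n) ->
  exists l, u @ \oo --> l /\ forall n, `|l - u n| <= M * q ^+ n / (1 - q).
Proof.
move=> M0 /andP[q0 q1] uM.
have q10 : 0 < 1 - q by rewrite subr_gt0.
have C0 n : 0 <= M * q ^+ n / (1 - q).
  by rewrite divr_ge0 ?mulr_ge0 ?exprn_ge0 ?(ltW q10).
(* The factor [1 - q ^+ m] is what makes the induction close; it is dropped in [unm']. *)
have unm n m : `|u (n + m)%N - u n| <= M * q ^+ n / (1 - q) * (1 - q ^+ m).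
  elim: m => [|m IH]; first by rewrite addn0 subrr normr0 expr0 subrr mulr0.
  rewrite addnS -(subrK (u (n + m)%N) (u (n + m).+1)) -addrA.
  rewrite (le_trans (ler_normD _ _))//.
  rewrite (le_trans (lerD (uM _) IH))// exprD exprS.
  rewrite [M * (_ * _)](_ : _ = M * q ^+ n / (1 - q) * ((1 - q) * q ^+ m)).
    by rewrite -mulrDr; apply: ler_wpM2l => //; lra.
  by rewrite [RHS]mulrA divfK ?gt_eqF// mulrA.
have unm' n m : `|u (n + m)%N - u n| <= M * q ^+ n / (1 - q).
  rewrite (le_trans (unm n m))// -[leRHS]mulr1 ler_wpM2l//.
  by rewrite gerBl exprn_ge0.
have cu : cvgn u.
  have -> : u = (fun n => u 0 + series (telescope u) n).
      by apply/funext => n; exact: eq_sum_telescope.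
  apply: is_cvgD; first exact: is_cvg_cst.
  apply: normed_cvg; apply: (@series_le_cvg _ _ (geometric M q)).
  - by move=> n; exact: normr_ge0.
  - by move=> n /=; rewrite mulr_ge0 ?exprn_ge0.
  - by move=> n /=; exact: uM.
  - by apply: is_cvg_geometric_series; rewrite ger0_norm.
exists (limn u); split => // n.
have cn : `|u (n + m)%N - u n| @[m --> \oo] --> `|limn u - u n|.
  apply: cvg_norm; apply: cvgB; last exact: cvg_cst.
  under eq_fun do rewrite addnC.
  have : [sequence u (m + n)%N]_m @ \oo --> limn u by rewrite cvg_shiftn.
  exact.
by apply: (cvgr_to_le cn); exact: nearW.
Qed.

(** The solution is the fixed point of [x |-> y - s x], a contraction of the closed ball of radius
    [r] into itself: [|y|] and [|s x|] are each at most [r / 2]. *)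
Lemma picard (V : completeNormedModType R) (s : V -> V) (r : R) (y : V) :
  0 <= r -> s 0 = 0 ->
  (forall x x', `|x| <= r -> `|x'| <= r -> `|s x - s x'| <= 2^-1 * `|x - x'|) ->
  `|y| <= r / 2 -> exists2 x, `|x| <= r & x + s x = y.
Proof.
move=> r0 s0 slip yr; pose u n := iter n (fun x => y - s x) 0.
have ur n : `|u n| <= r.
  elim: n => [|n IH] /=; first by rewrite normr0.
  rewrite (le_trans (ler_normB _ _))//.
  have := slip (u n) 0 IH; rewrite normr0 s0 !subr0 => /(_ r0) sr; lra.
have ud n : `|u n.+1 - u n| <= `|y| * 2^-1 ^+ n.
  elim: n => [|n IH] /=; first by rewrite s0 !subr0 mulr1.
  rewrite opprD opprK addrACA subrr add0r addrC distrC.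
  have := slip _ _ (ur n.+1) (ur n); rewrite /= exprS => sn.
  by rewrite (le_trans sn)// mulrCA ler_wpM2l// invr_ge0.
have [|l [ul ln]] := geometric_limit (normr_ge0 y) _ ud.
  by apply/andP; split; lra.
have lr : `|l| <= r.
  by apply: (cvgr_to_le (cvg_norm ul)); exact: nearW.
exists l => //; apply/eqP; rewrite -subr_eq0 -normr_le0.
apply/ler_addgt0Pr => e e0; rewrite add0r.
have /cvgrPdist_lt/(_ (e / 2)) := ul; rewrite divr_gt0// => /(_ isT) [N _ uN].
have a1 : `|l - u N| < e / 2 by apply: (uN N); exact: leqnn.
have a2 : `|l - u N.+1| < e / 2 by apply: (uN N.+1); exact: leqnSn.
have -> : l + s l - y = (l - u N.+1) + (s l - s (u N)).
  by rewrite /= opprB [RHS]addrACA [_ - y - _]addrAC subrr add0r.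
rewrite (le_trans (ler_normD _ _))//.
have := slip _ _ lr (ur N); lra.
Qed.

(** The neighbourhood on which [g] is [e]-close to a strictly differentiable map in Lipschitz
    seminorm may shrink with [e]. By [tangent_dist] the derivatives of the approximations form a
    Cauchy sequence regardless of these neighbourhoods, and their limit is the derivative of [g].
    This is how regularity passes to the limit of [A^-n f^n]. *)
Lemma strict_diff_approx (V : normedModType R) (W : completeNormedModType R)
    (g : V -> W) (x : V) :
  (forall e, 0 < e -> exists g' L, strict_diff g' x L /\
    exists2 delta, 0 < delta & forall y z, `|y - x| < delta ->
      `|z - x| < delta -> `|(g y - g' y) - (g z - g' z)| <= e * `|y - z|) ->
  exists L, strict_diff g x L.
Proof.
move=> app.
have app' (n : nat) : exists L : V -> W, bounded_linear L /\
    exists2 delta, 0 < delta & forall y z, `|y - x| < delta ->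
      `|z - x| < delta -> `|g y - g z - L (y - z)| <= 2^-1 ^+ n * `|y - z|.
  have e0 : 0 < 2^-1 ^+ n / 2 :> R by rewrite divr_gt0// exprn_gt0// invr_gt0.
  have [g' [L [[bL gL] [d d0 gd]]]] := app _ e0.
  have [d' d'0 gd'] := gL _ e0.
  exists L; split => //; exists (Num.min d d'); first by rewrite lt_min d0.
  move=> y z; rewrite !lt_min => /andP[y1 y2] /andP[z1 z2].
  have -> : g y - g z - L (y - z) = (g y - g' y - (g z - g' z)) +
      (g' y - g' z - L (y - z)).
    rewrite [RHS]addrA; congr (_ - _).
    by rewrite opprB -[RHS]addrA [X in _ = _ + X]addrC subrKA subrKA.
  rewrite (le_trans (ler_normD _ _))//.
  by rewrite [X in X * _]splitr mulrDl lerD ?gd ?gd'.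
have [L LP] := choice app'.
have Ld n m v : `|L n v - L m v| <= (2^-1 ^+ n + 2^-1 ^+ m) * `|v|.
  have [bLn [d d0 gd]] := LP n; have [bLm [d' d'0 gd']] := LP m.
  have m0 : 0 < Num.min d d' by rewrite lt_min d0.
  have xx : x - x = 0 by exact: subrr.
  apply: (tangent_dist (g := g) (x := x) bLn bLm m0) => {}v; rewrite lt_min => /andP[v1 v2].
    have := gd (x + v) x; rewrite [x + v - x]addrAC xx normr0 add0r; exact.
  have := gd' (x + v) x; rewrite [x + v - x]addrAC xx normr0 add0r; exact.
have Lcvg v : exists l, L n v @[n --> \oo] --> l /\
    forall n, `|l - L n v| <= 4 * 2^-1 ^+ n * `|v|.
  (* The [2] bounds [1 + 2^-1], from two consecutive tangents; [2 / (1 - 2^-1)] is the [4] in the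
     rate. *)
  have [||n|l [Ll ln]] := @geometric_limit _ (fun n => L n v) (2 * `|v|) 2^-1.
  - by rewrite mulr_ge0.
  - by apply/andP; split; lra.
  - rewrite (le_trans (Ld _ _ _))// -mulrA [`|v| * _]mulrC mulrA ler_wpM2r//.
    rewrite exprS mulrDl mul1r lerD// -[leRHS]mul1r ler_wpM2r ?exprn_ge0 ?invr_ge0//.
    by rewrite invf_le1// ler1n.
  exists l; split => // n; rewrite (le_trans (ln n))//.
  suff -> : 2 * `|v| * 2^-1 ^+ n / (1 - 2^-1) = 4 * 2^-1 ^+ n * `|v| by [].
  by field.
have [L' L'P] := choice Lcvg.
have L'lin : linear L'.
  move=> a u v; have [cuv _] := L'P (a *: u + v).
  have [cu _] := L'P u; have [cv _] := L'P v.
  apply: (cvg_unique _ cuv) => //.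
  have -> : (fun n => L n (a *: u + v)) = (fun n => a *: L n u + L n v).
    by apply/funext => n; have [[bL _] _] := LP n; exact: bL.
  by apply: cvgD => //; apply: cvgZr.
exists L'; split.
  split => //; have [[_ [M M0 LM]] _] := LP 0.
  exists (4 + M); first exact: addr_ge0.
  move=> v; rewrite -(subrK (L 0 v) (L' v)) (le_trans (ler_normD _ _))//.
  rewrite mulrDl lerD//; have := (L'P v).2 0.
  by rewrite expr0 mulr1.
(* [5 = 1 + 4]: the error of [L n] as a tangent of [g], plus its distance to [L']. *)
move=> e e0; have : (5 * 2^-1 ^+ n : R) @[n --> \oo] --> (5 * 0 : R).
  apply: cvgM; first exact: cvg_cst.
  by apply: cvg_expr; rewrite ger0_norm ?invr_ge0// invf_lt1// ltr1n.
rewrite mulr0 => /cvgrPdist_lt/(_ _ e0)[n _ /(_ n (leqnn _))].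
rewrite sub0r normrN ger0_norm ?mulr_ge0 ?exprn_ge0 ?invr_ge0// => ne.
have [_ [d d0 gd]] := LP n; exists d => // y z yx zx.
have -> : g y - g z - L' (y - z) =
    g y - g z - L n (y - z) + (L n (y - z) - L' (y - z)) by rewrite subrKA.
have Ln : `|L n (y - z) - L' (y - z)| <= 4 * 2^-1 ^+ n * `|y - z|.
  by rewrite distrC (L'P _).2.
rewrite (le_trans (ler_normD _ _))// (le_trans (lerD (gd _ _ yx zx) Ln))//.
rewrite -mulrDl ler_wpM2r//; lra.
Qed.

(** Applying [L'] to the strict estimate of [h] between [g u] and [g v] produces
    [L' (u - v) - (g u - g v)]; the Lipschitz bound on [g] then turns an error in [|g u - g v|] into
    one in [|u - v|]. *)
Lemma strict_diff_inverse (V W : normedModType R) (h : V -> W) (g : W -> V) (y : W)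
    (L : V -> W) (L' : W -> V) (K r : R) :
  0 < r -> 0 < K -> strict_diff h (g y) L -> bounded_linear L' ->
  cancel L L' ->
  (forall u, `|u - y| < r -> h (g u) = u) ->
  (forall u v, `|u - y| < r -> `|v - y| < r -> `|g u - g v| <= K * `|u - v|) ->
  strict_diff g y L'.
Proof.
move=> r0 K0 [bL hL] bL' LK hg gK; split => // e e0.
have [_ [M M0 LM]] := bL'.
have [|d d0 hd] := hL (e / (K * (M + 1))).
  by rewrite divr_gt0// mulr_gt0// ltr_wpDl.
exists (Num.min r (d / K)); first by rewrite lt_min r0 divr_gt0.
move=> u v; rewrite !lt_min => /andP[u1 u2] /andP[v1 v2].
have yy : `|y - y| < r by rewrite subrr normr0.
have gd w : `|w - y| < r -> `|w - y| < d / K -> `|g w - g y| < d.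
  by move=> w1 w2; rewrite (le_lt_trans (gK _ _ w1 yy))// mulrC -ltr_pdivlMr.
have := hd _ _ (gd _ u1 u2) (gd _ v1 v2); rewrite !hg// => H.
have -> : g u - g v - L' (u - v) = - L' (u - v - L (g u - g v)).
  by rewrite [L' (_ - L _)](bounded_linearB _ _ bL') LK opprB.
rewrite normrN (le_trans (LM _))// (le_trans (ler_wpM2l M0 H))//.
rewrite (le_trans (ler_wpM2l M0 (ler_wpM2l _ (gK _ _ u1 v1))))//.
  by rewrite divr_ge0 ?(ltW e0)// mulr_ge0 ?(ltW K0)// addr_ge0.
have -> : M * (e / (K * (M + 1)) * (K * `|u - v|)) = (M / (M + 1)) * (e * `|u - v|).
  by field; rewrite !gt_eqF// ltr_wpDl.
rewrite ler_piMl ?mulr_ge0 ?(ltW e0)// ler_pdivrMr ?mul1r ?lerDl//.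
by rewrite ltr_wpDl.
Qed.

End Complete.

(** * Spectral radius and adapted norms *)

Section SpectralRadius.
Context {R : realType}.

Lemma powRV_le (u b : R) (n : nat) : 0 <= u -> 0 <= b -> (0 < n)%N ->
  (u `^ (n%:R^-1) <= b) = (u <= b ^+ n).
Proof.
move=> u0 b0 n0.
have nz : n%:R != 0 :> R by rewrite pnatr_eq0 -lt0n.
have uE : u = (u `^ (n%:R^-1)) ^+ n.
  by rewrite -powR_mulrn ?powR_ge0// -powRrM mulVf// powRr1.
by rewrite [X in _ = (X <= _)]uE ler_pXn2r ?nnegrE ?powR_ge0.
Qed.

Lemma bounded_linear_iter (V : normedModType R) (T : V -> V) n :
  bounded_linear T -> bounded_linear (iter n T).
Proof.
move=> bT; elim: n => [|n IH]; last exact: (bounded_linear_comp IH bT).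
split; first by move=> a u v.
by exists 1 => // v; rewrite mul1r.
Qed.

(** An equivalent norm, dominating the given one, for which a single application of [T] has factor
    [a]. Being a plain function, it allows norms adapted to different operators on one space. *)
Definition adapted_norm (V : normedModType R) (T : V -> V) (a : R) (N : V -> R) :=
  [/\ forall x y, N (x + y) <= N x + N y,
      forall x, N (- x) = N x,
      forall x, `|x| <= N x,
      forall x, N (T x) <= a * N x
    & exists2 c, 0 < c & forall x, N x <= c * `|x|].

Lemma adapted_norm_iter (V : normedModType R) (T : V -> V) (a : R) N n x :
  0 <= a -> adapted_norm T a N -> N (iter n T x) <= a ^+ n * N x.
Proof.
move=> a0 [_ _ _ NT _]; elim: n => [|n IH]; first by rewrite expr0 mul1r.
by rewrite /= (le_trans (NT _))// exprS -mulrA ler_wpM2l.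
Qed.

Lemma adapted_norm_ge0 (V : normedModType R) (T : V -> V) (a : R) N x :
  adapted_norm T a N -> 0 <= N x.
Proof. by move=> [_ _ N1 _ _]; exact: le_trans (N1 x). Qed.

Lemma adapted_norm0 (V : normedModType R) (T : V -> V) (a : R) N :
  adapted_norm T a N -> N 0 = 0.
Proof.
move=> aN; have [_ _ _ _ [c c0 Nc]] := aN.
apply/eqP; rewrite eq_le (adapted_norm_ge0 _ aN) andbT.
by have := Nc 0; rewrite normr0 mulr0.
Qed.

Lemma adapted_norm_open (V : normedModType R) (T : V -> V) (a : R) N x rho :
  adapted_norm T a N -> N x < rho ->
  exists2 delta, 0 < delta & forall y, `|y - x| < delta -> N y < rho.
Proof.
move=> [ND _ _ _ [c c0 Nc]] xr.
exists ((rho - N x) / c); first by rewrite divr_gt0// subr_gt0.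
move=> y; rewrite ltr_pdivlMr// => yx; rewrite -(subrK x y).
rewrite (le_lt_trans (ND _ _))// -ltrBrDr (le_lt_trans (Nc _))//.
by rewrite mulrC.
Qed.

(** [N x] sums [|T^k x| / a^k] over [k < K]. Replacing [x] by [T x] shifts the sum, up to the factor
    [a], and the new last term [|T^K x| / a^K] is at most the lost first term [|x|]. *)
Lemma exists_adapted_norm (V : normedModType R) (T : V -> V) (a : R) K :
  bounded_linear T -> 0 < a -> (0 < K)%N ->
  (forall x, `|iter K T x| <= a ^+ K * `|x|) ->
  exists N, adapted_norm T a N.
Proof.
move=> bT a0 K0 TK; pose N x : R := \sum_(k < K) `|iter k T x| / a ^+ k.
have bTn n := bounded_linear_iter n bT.
exists N; split.
- move=> x y; rewrite -big_split ler_sum// => k _.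
  by rewrite /= -mulrDl ler_wpM2r ?invr_ge0 ?exprn_ge0 ?(ltW a0)// bounded_linearD// ler_normD.
- move=> x; apply: eq_bigr => k _.
  by rewrite -scaleN1r bounded_linearZ// scaleN1r normrN.
- move=> x; case: K K0 @N {TK} => // K _ N; rewrite /N big_ord_recl expr0 divr1 lerDl.
  by apply: sumr_ge0 => k _; rewrite divr_ge0 ?exprn_ge0 ?(ltW a0).
- move=> x; case: K K0 TK @N => // K _ TK N; rewrite /N mulr_sumr.
  under [leLHS]eq_bigr do rewrite -iterSr.
  rewrite big_ord_recr [leRHS]big_ord_recl [leRHS]addrC lerD//.
    apply: ler_sum => k _; rewrite lift0 exprS le_eqVlt; apply/orP; left.
    apply/eqP; rewrite [RHS]mulrCA invfM mulVKf ?gt_eqF//.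
  rewrite /= divr1 ler_pdivrMr ?exprn_gt0//.
  by rewrite (le_trans (TK x))// exprS mulrAC.
- have /choice[M MP] k : exists M : R, 0 <= M /\ forall x, `|iter k T x| <= M * `|x|.
    by have [_ [M M0 MT]] := bTn k; exists M.
  exists (1 + \sum_(k < K) M k / a ^+ k).
    rewrite ltr_wpDr//; apply: sumr_ge0 => k _.
    by rewrite divr_ge0 ?exprn_ge0 ?(ltW a0)//; have [] := MP k.
  move=> x; rewrite mulrDl mul1r mulr_suml ler_wpDl// ler_sum// => k _.
  rewrite mulrAC ler_wpM2r ?invr_ge0 ?exprn_ge0 ?(ltW a0)//.
  by have [_] := MP k; apply.
Qed.

(* The limit is the infimum: once [|T^K| <= a^K] for a single [K > 0], the
   adapted norm yields [|T^n| <= c a^n] for all [n]. *)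
Lemma spectral_radius_cvg (V : normedModType R) (T : V -> V) : bounded_linear T ->
  ((opnorm (iter k T)) `^ (k%:R^-1) @[k --> \oo]) --> spectral_radius T.
Proof.
move=> bT; pose u k := opnorm (iter k T); pose v k := u k `^ (k%:R^-1).
have u0 k : 0 <= u k by exact: opnorm_ge0.
suff cv : cvgn v by exact: cv.
(* [k = 0] is left out: [0^-1 = 0] makes [v 0 = 1], which says nothing about [T]. *)
pose S := [set v k | k in [set k | (0 < k)%N]].
have S1 : S (v 1%N) by exists 1%N.
have S0 : lbound S 0 by move=> _ [k _ <-]; exact: powR_ge0.
have iS : has_inf S by split; [exists (v 1%N) | exists 0].
have l0 : 0 <= inf S by apply: lb_le_inf => //; exists (v 1%N).
apply: (cvgP (inf S)); apply/cvgrPdist_le => e e0.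
have [_ [K K0 <-] vK] := inf_adherent (divr_gt0 e0 (ltr0Sn _ 1)) iS.
set a := inf S + e / 2 in vK.
have a0 : 0 < a by rewrite ltr_wpDl// divr_gt0.
have bTn n := bounded_linear_iter n bT.
have TK x : `|iter K T x| <= a ^+ K * `|x|.
  apply: opnorm_le => //.
  by rewrite -[leLHS]/(u K) -powRV_le ?(ltW a0)//; exact: ltW.
have [N aN] := exists_adapted_norm bT a0 K0 TK.
have [_ _ N1 NT [c c0 Nc]] := aN.
have un n : u n <= c * a ^+ n.
  apply: opnorm_ub; first by rewrite mulr_ge0 ?exprn_ge0 ?(ltW _).
  move=> x; rewrite (le_trans (N1 _))//.
  rewrite (le_trans (adapted_norm_iter _ _ (ltW a0) aN))//.
  by rewrite [c * _]mulrC -mulrA ler_wpM2l// exprn_ge0// ltW.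
(* With this [d], [inf S + e = (1 + d) * a]; by Bernoulli's inequality [(1 + d) ^+ n] eventually
   exceeds [c]. *)
pose d := e / 2 / a; have d0 : 0 < d by rewrite !divr_gt0.
near=> n.
have n0 : (0 < n)%N by near: n; exact: nbhs_infty_gt.
have vn : inf S <= v n by apply: ge_inf; [exists 0|exists n].
rewrite distrC ger0_norm ?subr_ge0// lerBlDl.
have le0 : 0 <= inf S + e by rewrite addr_ge0// ltW.
rewrite powRV_le// (le_trans (un n))//.
have -> : inf S + e = (1 + d) * a.
  by rewrite mulrDl mul1r /d divfK ?gt_eqF// /a -addrA -splitr.
rewrite exprMn ler_wpM2r ?exprn_ge0 ?(ltW a0)//.
have cn : c <= n%:R * d.
  by rewrite -ler_pdivrMr//; near: n; exact: nbhs_infty_ger.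
rewrite (le_trans cn)//.
suff H m : 1 + m%:R * d <= (1 + d) ^+ m by apply: le_trans (H n); rewrite lerDr.
elim: m => [|m IH]; first by rewrite mul0r addr0.
rewrite exprS (le_trans _ (ler_wpM2l _ IH))//; last by rewrite addr_ge0// ltW.
have := mulr_ge0 (ler0n R m) (mulr_ge0 (ltW d0) (ltW d0)).
rewrite -natr1; nra.
Unshelve. all: by end_near. Qed.

End SpectralRadius.

Section Contracting.
Context {R : realType}.

Lemma spectral_radius_ge0 (V : normedModType R) (T : V -> V) :
  bounded_linear T -> 0 <= spectral_radius T.
Proof.
move=> bT; apply: (cvgr_to_ge (spectral_radius_cvg bT)).
by apply: nearW => n; exact: powR_ge0.
Qed.

Lemma spectral_radius_adapted (V : normedModType R) (T : V -> V) (a : R) :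
  bounded_linear T -> spectral_radius T < a -> exists N, adapted_norm T a N.
Proof.
move=> bT Ta; have cT := spectral_radius_cvg bT.
have a0 := le_lt_trans (spectral_radius_ge0 bT) Ta.
have [K _ KP] := cvgr_lt _ cT _ Ta.
apply: (@exists_adapted_norm _ _ _ _ K.+1) => //; apply: opnorm_le.
  exact: bounded_linear_iter.
rewrite -powRV_le ?opnorm_ge0 ?(ltW a0)//; apply: ltW.
by apply: (KP K.+1); exact: leqnSn.
Qed.

(** The strict inequality in [alpha_contracting] leaves room to enlarge both radii slightly, and
    adapted norms realise the enlarged values. The rate [a0] of [A] is kept strictly below [a] as a
    margin for the nonlinear part. *)
Lemma contracting_adapted (V : normedModType R) (A Ainv : V -> V) (alpha : R) :
  (exists v : V, v != 0) -> bounded_linear A -> bounded_linear Ainv ->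
  cancel A Ainv -> 0 < alpha -> alpha_contracting alpha A Ainv ->
  exists a b NA NB, [/\ 0 < a < 1, 0 < b & a `^ (1 + alpha) * b < 1] /\
    exists2 a0, 0 < a0 < a & adapted_norm A a0 NA /\ adapted_norm Ainv b NB.
Proof.
move=> [v0 v0n0] bA bAi AK al0; rewrite /alpha_contracting => pr1.
have rA := spectral_radius_ge0 bA; have rAi := spectral_radius_ge0 bAi.
set p := _ `^ _ in pr1; set r := spectral_radius Ainv in pr1 rAi.
have p0 : 0 <= p by exact: powR_ge0.
have al1 : 0 < 1 + alpha by rewrite addr_gt0.
(* As [e <= 1], [(p + e) * (r + e) <= p * r + e * (p + r + 1) = (1 + p * r) / 2 < 1]. *)
pose e := (1 - p * r) / (2 * (p + r + 1)).
have d0 : 0 < 2 * (p + r + 1) by lra.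
have e0 : 0 < e by rewrite divr_gt0// subr_gt0.
have prge0 : 0 <= p * r by exact: mulr_ge0.
have eE : e * (p + r + 1) = (1 - p * r) / 2.
  rewrite /e; field; lra.
have e1 : e <= 1.
  rewrite ler_pdivrMr// mul1r; nra.
have e2 : (p + e) * (r + e) < 1 by nra.
pose a := (p + e) `^ (1 + alpha)^-1.
have aE : a `^ (1 + alpha) = p + e.
  by rewrite -powRrM mulVf ?gt_eqF// powRr1// addr_ge0// ltW.
have Aa : spectral_radius A < a.
  have -> : spectral_radius A = p `^ (1 + alpha)^-1.
    by rewrite -powRrM mulfV ?gt_eqF// powRr1.
  by apply: gt0_ltr_powR; rewrite ?invr_gt0 ?nnegrE ?addr_ge0 ?ltrDl// ltW.
have rre : r < r + e by rewrite ltrDl.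
have [NB aNB] := spectral_radius_adapted bAi rre.
pose a0 := (spectral_radius A + a) / 2.
have a00 : 0 < a0 by rewrite /a0; lra.
have a0a : a0 < a by rewrite /a0; lra.
have Aa0 : spectral_radius A < a0 by rewrite /a0; lra.
have [NA aNA] := spectral_radius_adapted bA Aa0.
have a_gt0 : 0 < a by exact: lt_trans a0a.
have b0 : 0 < r + e by exact: ltr_wpDl.
(* [Ainv^n A^n = id] forces [a0 b >= 1]; hence [a^alpha < 1]. *)
have ab : 1 <= a0 * (r + e).
  have [_ _ A1 _ [ca ca0 cA]] := aNA; have [_ _ B1 _ [cb cb0 cB]] := aNB.
  have v0p : 0 < `|v0| by rewrite normr_gt0.
  have H n : 1 <= cb * ca * (a0 * (r + e)) ^+ n.
    rewrite -(ler_pM2r v0p) mul1r.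
    have {1}-> : v0 = iter n Ainv (iter n A v0).
      by elim: n => // n IH; rewrite iterSr iterS AK.
    rewrite (le_trans (B1 _))//.
    rewrite (le_trans (adapted_norm_iter _ _ (ltW b0) aNB))//.
    rewrite (le_trans (ler_wpM2l _ (cB _)))// ?exprn_ge0 ?(ltW b0)//.
    rewrite (le_trans (ler_wpM2l _ (ler_wpM2l (ltW cb0) (A1 _))))// ?exprn_ge0 ?(ltW b0)//.
    have := adapted_norm_iter n v0 (ltW a00) aNA.
    move=> /le_trans /(_ (ler_wpM2l (exprn_ge0 n (ltW a00)) (cA _))) H.
    rewrite (le_trans (ler_wpM2l _ (ler_wpM2l (ltW cb0) H)))// ?exprn_ge0 ?(ltW b0)//.
    rewrite [(a0 * _) ^+ n]exprMn le_eqVlt; apply/orP; left; apply/eqP.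
    by ring.
  rewrite leNgt; apply/negP => ab1.
  have : (cb * ca * (a0 * (r + e)) ^+ n) @[n --> \oo] --> cb * ca * 0.
    apply: cvgM; first exact: cvg_cst.
    by apply: cvg_expr; rewrite ger0_norm// mulr_ge0// ltW.
  rewrite mulr0 => /cvgr_lt/(_ _ ltr01)[n _ /(_ n (leqnn _))].
  by rewrite ltNge H.
have a1 : a < 1.
  rewrite ltNge; apply/negP => a1.
  have : 1 <= a `^ (1 + alpha) by rewrite (le_trans a1)// le1r_powR// lerDl ltW.
  move=> h; have : a <= a `^ (1 + alpha) by rewrite le1r_powR// lerDl ltW.
  rewrite aE; nra.
exists a, (r + e), NA, NB; split; first by rewrite a_gt0 a1 aE.
by exists a0 => //; rewrite a00.
Qed.

End Contracting.

Lemma subrACA (V : zmodType) (x y z t : V) : x - y - (z - t) = x - z - (y - t).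
Proof. by rewrite opprD addrACA -opprD. Qed.

(** * Maps with Hölder continuous derivative *)

Section Holder.
Context {R : realType}.
Implicit Types V W : normedModType R.

Lemma powR_small (K e alpha : R) : 0 <= K -> 0 < e -> 0 < alpha ->
  exists2 s, 0 < s & K * s `^ alpha <= e.
Proof.
move=> K0 e0 al0; have K1 : 0 < K + 1 by exact: ltr_wpDl.
exists ((e / (K + 1)) `^ alpha^-1); first by apply: powR_gt0; exact: divr_gt0.
rewrite -powRrM mulVf ?gt_eqF// powRr1 ?divr_ge0 ?(ltW e0) ?(ltW K1)//.
by rewrite mulrCA ler_piMr ?(ltW e0)// ler_pdivrMr// mul1r lerDl.
Qed.

Lemma holder_dist V W (g : V -> W) (alpha : R) (U : set V) :
  C1_holder_on alpha U g -> exists2 K : R, 0 <= K &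
    forall x y, U x -> U y -> forall v,
      `|'d g y v - 'd g x v| <= K * `|y - x| `^ alpha * `|v|.
Proof.
move=> [dg [K gK]]; exists (Num.max K 0); first by rewrite le_max lexx orbT.
move=> x y Ux Uy; apply: (@opnorm_le _ _ _ (fun v => 'd g y v - 'd g x v)).
  by apply: bounded_linear_sub; exact: diff_bounded_linear (dg _ _).
by rewrite (le_trans (gK _ _ Ux Uy))// ler_wpM2r ?powR_ge0// le_max lexx.
Qed.

(** On a ball of radius [s] the derivative differs from its value at the centre by at most
    [K s^alpha], which [mean_value_sub] turns into a Lipschitz constant. The dependence on [s]
    matters, since the bound is used on shrinking balls. *)
Lemma holder_lip V W (g : V -> W) (alpha : R) (U : set V) x r :
  0 < alpha -> C1_holder_on alpha U g -> U x ->
  (forall y, `|y - x| < r -> U y) ->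
  exists2 K : R, 0 <= K & forall s y z, s <= r -> `|y - x| < s -> `|z - x| < s ->
    `|g y - g z - 'd g x (y - z)| <= K * s `^ alpha * `|y - z|.
Proof.
move=> al0 gH Ux rU; have [K K0 gK] := holder_dist gH; exists K => // s y z sr ys zs.
apply: mean_value_sub; first exact: diff_bounded_linear (gH.1 _ Ux).
move=> t t01; have ps := ball_segment ys zs t01.
have Up := rU _ (lt_le_trans ps sr); split; first exact: gH.1.
rewrite (le_trans (gK _ _ Ux Up _))// ler_wpM2r// ler_wpM2l//.
apply: (ge0_ler_powR (ltW al0)); rewrite ?nnegrE ?(ltW ps)//.
exact: le_trans (ltW ys).
Qed.

Lemma open_ball V (U : set V) x : open U -> U x ->
  exists2 r : R, 0 < r & forall y, `|y - x| < r -> U y.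
Proof.
move=> oU Ux; have /nbhs_normP[r /= r0 rU] : nbhs x U by exact: open_nbhs_nbhs.
by exists r => // y yx; apply: rU; rewrite /= distrC.
Qed.

Lemma holder_strict_diff V W (g : V -> W) (alpha : R) (U : set V) x :
  0 < alpha -> C1_holder_on alpha U g -> open U -> U x ->
  strict_diff g x ('d g x).
Proof.
move=> al0 gH oU Ux; have [r r0 rU] := open_ball oU Ux.
have [K K0 gK] := holder_lip al0 gH Ux rU.
split; first exact: diff_bounded_linear (gH.1 _ Ux).
move=> e e0; have [s s0 se] := powR_small K0 e0 al0.
exists (Num.min s r); first by rewrite lt_min s0.
move=> y z ys zs.
have sr : Num.min s r <= r by rewrite ge_min lexx orbT.
rewrite (le_trans (gK _ _ _ sr ys zs))// ler_wpM2r// (le_trans _ se)// ler_wpM2l//.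
by apply: ge0_ler_powR; rewrite ?nnegrE ?(ltW al0) ?(ltW s0)// ?ge_min ?lexx//
  le_min ?(ltW s0) ltW.
Qed.

Lemma bounded_linear_cvg V W (L : V -> W) (u : nat -> V) l :
  bounded_linear L -> u n @[n --> \oo] --> l -> L (u n) @[n --> \oo] --> L l.
Proof.
move=> bL ul; have [_ [M M0 LM]] := bL.
have M1 : 0 < M + 1 by exact: ltr_wpDl.
apply/cvgrPdist_le => e e0; move/cvgrPdist_le: ul => /(_ (e / (M + 1))).
rewrite divr_gt0// => /(_ isT); apply: filterS => n un.
rewrite -bounded_linearB// (le_trans (LM _))//.
rewrite (le_trans (ler_wpM2l M0 un))// mulrCA ler_piMr ?(ltW e0)//.
by rewrite ler_pdivrMr// mul1r lerDl.
Qed.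

End Holder.

(** * Local linearization *)

Section Linearization.
Context {R : realType} (B : completeNormedModType R) (A Ainv ft : B -> B).
Context (alpha a0 a b r K : R) (NA NB : B -> R).
Context (bA : bounded_linear A) (bAi : bounded_linear Ainv).
Context (AK : cancel A Ainv) (AiK : cancel Ainv A).
Context (al0 : 0 < alpha) (a00 : 0 < a0) (a0a : a0 < a) (a1 : a < 1) (b0 : 0 < b).
Context (ab1 : a `^ (1 + alpha) * b < 1).
Context (aNA : adapted_norm A a0 NA) (aNB : adapted_norm Ainv b NB).
Context (r0 : 0 < r) (K0 : 0 <= K) (ft0 : ft 0 = 0).
Context (ftK : forall s y z, s <= r -> `|y| < s -> `|z| < s ->
    `|ft y - ft z| <= K * s `^ alpha * `|y - z|).
Context (ftS : forall y, `|y| < r -> exists L, strict_diff ft y L).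

Let f x := A x + ft x.
Let a_gt0 : 0 < a. Proof. exact: lt_trans a0a. Qed.

(** One factor per source: [a] from the contraction of differences of orbits, [a^alpha] from the
    Hölder bound on the shrinking ball, [b] from [Ainv]. *)
Let q := a * a `^ alpha * b.
Let q01 : 0 <= q < 1.
Proof.
rewrite /q; have aE : a `^ (1 + alpha) = a * a `^ alpha.
  by rewrite powRD ?powRr1 ?(ltW a_gt0)//; apply/implyP => _; rewrite gt_eqF.
by rewrite -aE ab1 andbT mulr_ge0 ?powR_ge0 ?(ltW b0).
Qed.

(** [A] contributes [a0]; in the norm [NA], the Lipschitz constant of [ft] on a ball of radius [s]
    is at most [c K s^alpha], hence at most [a - a0] for small [s]. *)
Lemma contraction_radius : exists rho, [/\ 0 < rho, rho <= r
  & forall x y, NA x < rho -> NA y < rho -> NA (f x - f y) <= a * NA (x - y)].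
Proof.
have [ND NN N1 NT [c c0 Nc]] := aNA.
have d0 : 0 < a - a0 by rewrite subr_gt0.
have [s s0 se] := powR_small (mulr_ge0 (ltW c0) K0) d0 al0.
exists (Num.min s r); split; rewrite ?lt_min ?s0// ?ge_min ?lexx ?orbT//.
move=> x y xs ys.
have -> : f x - f y = A (x - y) + (ft x - ft y).
  by rewrite (bounded_linearB _ _ bA) /f opprD addrACA.
rewrite (le_trans (ND _ _))//.
have x1 := le_lt_trans (N1 _) xs; have y1 := le_lt_trans (N1 _) ys.
have sr : Num.min s r <= r by rewrite ge_min lexx orbT.
have H := ftK sr x1 y1.
have := le_trans (Nc (ft x - ft y)) (ler_wpM2l (ltW c0) H).
have m0 : 0 <= Num.min s r by rewrite le_min (ltW s0) ltW.
have ms : (Num.min s r) `^ alpha <= s `^ alpha.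
  by apply: ge0_ler_powR; rewrite ?nnegrE ?(ltW al0) ?(ltW s0)// ge_min lexx.
have h1 : c * (K * Num.min s r `^ alpha * `|x - y|) <= c * K * s `^ alpha * NA (x - y).
  rewrite !mulrA; apply: ler_pM => //; rewrite ?mulr_ge0 ?powR_ge0 ?(ltW c0)//.
  by rewrite ler_wpM2l// mulr_ge0// ltW.
have := NT (x - y); have := ler_wpM2r (adapted_norm_ge0 (x - y) aNA) se.
lra.
Qed.

Section Conjugacy.
Context (rho : R) (rho0 : 0 < rho) (rhor : rho <= r).
Context (fN : forall x y, NA x < rho -> NA y < rho -> NA (f x - f y) <= a * NA (x - y)).

Let D s x := NA x < s.
Let f0 : f 0 = 0. Proof. by rewrite /f ft0 (bounded_linear0 bA) addr0. Qed.

Lemma adapted_ball_invariant s x : s <= rho -> D s x -> D (a * s) (f x).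
Proof.
move=> sr xs; have x0 := lt_le_trans xs sr.
have := fN x0 (_ : NA 0 < rho); rewrite (adapted_norm0 aNA) f0 !subr0 => /(_ rho0).
by move=> /le_lt_trans; apply; rewrite ltr_pM2l.
Qed.

Lemma adapted_ball_iter s n x : 0 < s -> s <= rho -> D s x -> D (a ^+ n * s) (iter n f x).
Proof.
move=> s0 sr xs; elim: n => [|n IH]; first by rewrite expr0 mul1r.
rewrite exprS -mulrA; apply: adapted_ball_invariant => //.
rewrite (le_trans _ sr)// ler_piMl ?(ltW s0)// exprn_ile1 ?(ltW a_gt0)// ltW//.
Qed.

Lemma adapted_ball_iter_rho n x : D rho x -> D rho (iter n f x).
Proof.
move=> xr; apply: lt_le_trans (adapted_ball_iter n rho0 (lexx _) xr) _.
by rewrite ler_piMl ?(ltW rho0)// exprn_ile1 ?(ltW a_gt0)// ltW.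
Qed.

Lemma iter_contraction n x y : D rho x -> D rho y ->
  NA (iter n f x - iter n f y) <= a ^+ n * NA (x - y).
Proof.
move=> xr yr; elim: n => [|n IH]; first by rewrite expr0 mul1r.
rewrite /= (le_trans (fN _ _))//; [exact: adapted_ball_iter_rho..|].
by rewrite exprS -mulrA ler_pM2l.
Qed.

Let hn n x := iter n Ainv (iter n f x).

Lemma iter_linearB n u v : iter n Ainv (u - v) = iter n Ainv u - iter n Ainv v.
Proof. by apply: bounded_linearB; exact: bounded_linear_iter. Qed.

Lemma conjugacy_step n x : hn n.+1 x - hn n x = iter n.+1 Ainv (ft (iter n f x)).
Proof.
rewrite /hn [iter n.+1 f x]iterS; set u := iter n f x.
have -> : iter n Ainv u = iter n.+1 Ainv (A u) by rewrite iterSr AK.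
by rewrite -iter_linearB /f addrAC subrr add0r.
Qed.

Lemma conjugacy_step_lip : exists2 C, 0 <= C & forall s n x y,
  0 < s -> s <= rho -> D s x -> D s y ->
  `|(hn n.+1 x - hn n x) - (hn n.+1 y - hn n y)|
    <= C * s `^ alpha * `|x - y| * q ^+ n.
Proof.
have [_ _ N1 _ [ca ca0 Nca]] := aNA; have [_ _ M1 _ [cb cb0 Mcb]] := aNB.
exists (b * cb * K * ca); first by rewrite !mulr_ge0// ltW.
move=> s n x y s0 sr xs ys; rewrite !conjugacy_step -iter_linearB.
have xr := lt_le_trans xs sr; have yr := lt_le_trans ys sr.
have an0 m : 0 < a ^+ m by rewrite exprn_gt0.
have bn0 m : 0 <= b ^+ m by rewrite exprn_ge0// ltW.
have as0 : 0 <= (a ^+ n * s) `^ alpha by exact: powR_ge0.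
have asr : a ^+ n * s <= r.
  rewrite (le_trans _ (le_trans sr rhor))// ler_piMl ?(ltW s0)//.
  by rewrite exprn_ile1 ?(ltW a_gt0)// ltW.
rewrite (le_trans (M1 _))// (le_trans (adapted_norm_iter _ _ (ltW b0) aNB))//.
rewrite (le_trans (ler_wpM2l (bn0 _) (Mcb _)))//.
have := ftK asr (le_lt_trans (N1 _) (adapted_ball_iter n s0 sr xs))
  (le_lt_trans (N1 _) (adapted_ball_iter n s0 sr ys)).
move=> /(ler_wpM2l (ltW cb0))/(ler_wpM2l (bn0 n.+1))/le_trans; apply.
have H : `|iter n f x - iter n f y| <= a ^+ n * (ca * `|x - y|).
  rewrite (le_trans (N1 _))// (le_trans (iter_contraction n xr yr))//.
  by rewrite ler_wpM2l// ltW.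
have c0 : 0 <= b ^+ n.+1 * (cb * (K * (a ^+ n * s) `^ alpha)).
  by rewrite !mulr_ge0// ltW.
rewrite mulrA mulrA [leLHS](_ : _ = b ^+ n.+1 * (cb * (K * (a ^+ n * s) `^ alpha)) *
   `|iter n f x - iter n f y|); last by rewrite !mulrA.
rewrite (le_trans (ler_wpM2l c0 H))//.
rewrite powRM ?(ltW (an0 _)) ?(ltW s0)//.
have -> : (a ^+ n) `^ alpha = (a `^ alpha) ^+ n.
  by rewrite -(powR_mulrn n (ltW a_gt0)) powRAC powR_mulrn// powR_ge0.
rewrite /q !exprMn exprS le_eqVlt; apply/orP; left; apply/eqP; ring.
Qed.

(** [geometric_limit] is applied to the differences [hn n x - hn n y], so that the rate holds in the
    Lipschitz seminorm, as [strict_diff_approx] demands. Pointwise convergence is the comparison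
    with [y = 0], where every [hn n] vanishes. *)
Lemma conjugacy_limit : exists h : B -> B, exists2 C, 0 <= C &
  (forall x, D rho x -> hn n x @[n --> \oo] --> h x) /\
  forall s n x y, 0 < s -> s <= rho -> D s x -> D s y ->
    `|(h x - hn n x) - (h y - hn n y)| <= C * s `^ alpha * `|x - y| * q ^+ n.
Proof.
have [C C0 hC] := conjugacy_step_lip; have [q0 q1] := andP q01.
have D0 s : 0 < s -> D s 0 by rewrite /D (adapted_norm0 aNA).
have hcvg x : D rho x -> exists l : B, hn n x @[n --> \oo] --> l.
  move=> xr; have [||n|l [hl _]] := @geometric_limit _ _ (hn ^~ x)
    (C * rho `^ alpha * `|x - 0|) q.
  - by rewrite !mulr_ge0 ?powR_ge0.
  - exact: q01.
  - have := hC _ n _ _ rho0 (lexx _) xr (D0 _ rho0).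
    suff -> : hn n.+1 0 - hn n 0 = 0 by rewrite subr0.
    rewrite conjugacy_step; have -> : iter n f 0 = 0 by elim: n => //= n ->.
    by rewrite ft0; apply: bounded_linear0; exact: bounded_linear_iter.
  - by exists l.
exists (fun x => limn (hn ^~ x)), (C / (1 - q)).
  by rewrite divr_ge0// subr_ge0 ltW.
have hlim x : D rho x -> hn n x @[n --> \oo] --> limn (hn ^~ x).
  by move=> /hcvg[l hl]; rewrite (cvg_lim _ hl).
split => // s n x y s0 sr xs ys.
have xr := lt_le_trans xs sr; have yr := lt_le_trans ys sr.
have [||m|l [hl ln]] := @geometric_limit _ _ (fun n => hn n x - hn n y)
    (C * s `^ alpha * `|x - y|) q.
- by rewrite !mulr_ge0 ?powR_ge0.
- exact: q01.
- by have := hC _ m _ _ s0 sr xs ys; rewrite subrACA.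
have -> : limn (hn ^~ x) - hn n x - (limn (hn ^~ y) - hn n y) = l - (hn n x - hn n y).
  have -> : l = limn (hn ^~ x) - limn (hn ^~ y).
    apply: (cvg_unique _ hl) => //.
    by apply: cvgB; exact: hlim.
  by rewrite subrACA.
apply: le_trans (ln n) _.
by rewrite le_eqVlt; apply/orP; left; apply/eqP; ring.
Qed.

Lemma iter_strict_diff n x : D rho x ->
  exists L, strict_diff (iter n f) x L.
Proof.
move=> xr; have [_ _ N1 _ _] := aNA.
elim: n => [|n [L IH]].
  exists id; apply: strict_diff_linear; split; first by move=> c u v.
  by exists 1 => // v; rewrite mul1r.
have [L' fL'] : exists L', strict_diff ft (iter n f x) L'.
  apply: ftS; apply: le_lt_trans (N1 _) _.
  exact: lt_le_trans (adapted_ball_iter_rho n xr) rhor.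
exists ((fun v => A v + L' v) \o L); apply: (strict_diff_comp IH).
by apply: strict_diff_add => //; exact: strict_diff_linear.
Qed.

Lemma linearizing_conjugacy : exists h : B -> B, [/\
    forall x, D rho x -> h (f x) = A (h x), h 0 = 0,
    forall x, D rho x -> exists L, strict_diff h x L
  & exists2 C, 0 <= C & forall s x y, 0 < s -> s <= rho -> D s x -> D s y ->
    `|h x - h y - (x - y)| <= C * s `^ alpha * `|x - y|].
Proof.
have [h [C C0 [hlim hC]]] := conjugacy_limit; have [q0 q1] := andP q01.
have [_ _ N1 _ _] := aNA.
have D0 : D rho 0 by rewrite /D (adapted_norm0 aNA).
exists h; split.
- move=> x xr; have fxr : D rho (f x) by have := adapted_ball_iter_rho 1 xr.
  apply: (cvg_unique _ (hlim _ fxr)) => //.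
  (* [A] undoes one [Ainv], so precomposing with [f] only shifts the index. *)
  have -> : (fun n => hn n (f x)) = (fun n => A (hn n.+1 x)).
    apply/funext => n; rewrite /hn -iterSr.
    by rewrite [iter n.+1 Ainv _]iterS AiK.
  apply: bounded_linear_cvg => //.
  have := hlim _ xr; rewrite -(cvg_shiftS (hn ^~ x)); exact.
- apply: (cvg_unique _ (hlim _ D0)) => //.
  have -> : (fun n => hn n 0) = (fun=> 0); last exact: cvg_cst.
  apply/funext => n; rewrite /hn; have -> : iter n f 0 = 0 by elim: n => //= n ->.
  by apply: bounded_linear0; exact: bounded_linear_iter.
- move=> x xr; apply: strict_diff_approx => e e0.
  have [n Hn] : exists n, C * rho `^ alpha * q ^+ n <= e.
    have : (C * rho `^ alpha * q ^+ n) @[n --> \oo] --> C * rho `^ alpha * 0.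
      apply: cvgM; first exact: cvg_cst.
      by apply: cvg_expr; rewrite ger0_norm.
    rewrite mulr0 => /cvgr_le/(_ _ e0)[n _ /(_ n (leqnn _)) Hn].
    by exists n.
  have [L fL] := iter_strict_diff n xr.
  exists (hn n), (iter n Ainv \o L); split.
    apply: (strict_diff_comp fL); apply: strict_diff_linear.
    exact: bounded_linear_iter.
  have [d d0 dD] := adapted_norm_open aNA xr; exists d => // y z yd zd.
  rewrite (le_trans (hC _ n _ _ rho0 (lexx _) (dD _ yd) (dD _ zd)))//.
  by rewrite mulrAC ler_wpM2r.
(* At [n = 0] the map [hn n] is the identity. *)
- exists C => // s x y s0 sr xs ys; have := hC _ 0%N _ _ s0 sr xs ys.
  by rewrite expr0 mulr1 subrACA.
Qed.

End Conjugacy.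
End Linearization.

(** * Local inversion of maps close to the identity *)

Section LocalInverse.
Context {R : realType}.

Lemma strict_diff_near_id (V : normedModType R) (h : V -> V) x L (k delta : R) :
  strict_diff h x L -> 0 < delta ->
  (forall y z, `|y - x| < delta -> `|z - x| < delta ->
     `|h y - h z - (y - z)| <= k * `|y - z|) ->
  forall v, `|L v - v| <= k * `|v|.
Proof.
move=> hL d0 hk v; suff H e : 0 < e -> `|L v - v| <= (e + k) * `|v|.
  have [->|v0] := eqVneq v 0.
    by rewrite (bounded_linear0 hL.1) subrr normr0 mulr0.
  have nv0 : 0 < `|v| by rewrite normr_gt0.
  apply/ler_addgt0Pl => e e0; have := H (e / `|v|) (divr_gt0 e0 nv0).
  by rewrite mulrDl divfK ?gt_eqF.
move=> e0; have [d' d'0 hd] := strict_diff_ball hL e0.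
have m0 : 0 < Num.min d' delta by rewrite lt_min d'0.
have bid : bounded_linear (@id V).
  by split => //; exists 1 => // u; rewrite mul1r.
apply: (tangent_dist (g := h) (x := x) hL.1 bid m0) => u.
  by rewrite lt_min => /andP[ud _]; exact: hd.
rewrite lt_min => /andP[_ ud]; have := hk (x + u) x.
by rewrite [x + u - x]addrAC subrr normr0 add0r; exact.
Qed.

Lemma near_id_lower (V : normedModType R) (u v : V) :
  `|u - v| <= 2^-1 * `|v| -> `|v| <= 2 * `|u|.
Proof.
move=> uv; have := ler_normB u (u - v); rewrite opprB addrC subrK; lra.
Qed.

(** Surjectivity is [picard] for [L - id] on the ball of radius [2 |u|]; injectivity and the bound 2
    on the inverse both come from [|v| <= 2 |L v|]. *)
Lemma near_id_inverse (V : completeNormedModType R) (L : V -> V) :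
  bounded_linear L -> (forall v, `|L v - v| <= 2^-1 * `|v|) ->
  exists L', [/\ bounded_linear L', cancel L L' & cancel L' L].
Proof.
move=> bL L12; have low v : `|v| <= 2 * `|L v| by exact: near_id_lower.
have inj : injective L.
  move=> u v uv; apply/eqP; rewrite -subr_eq0 -normr_le0.
  by have := low (u - v); rewrite (bounded_linearB _ _ bL) uv subrr normr0 mulr0.
have /choice[L' L'K] u : exists v, L v = u.
  have [||||v _ vu] := @picard _ V (fun v => L v - v) (2 * `|u|) u.
  - by rewrite mulr_ge0.
  - by rewrite (bounded_linear0 bL) subrr.
  - by move=> x y _ _; rewrite subrACA -(bounded_linearB _ _ bL).
  - by rewrite mulrAC mulfV// mul1r.
  - by exists v; rewrite -vu addrC subrK.
exists L'; split => // [|v]; last by apply: inj; rewrite L'K.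
split; first by move=> c u v; apply: inj; rewrite bL.1 !L'K.
by exists 2 => // v; have := low (L' v); rewrite L'K.
Qed.

(** As [h - id] is 1/2-Lipschitz, [picard] solves [h x = y] with a solution that is 2-Lipschitz in
    [y], and [strict_diff_inverse] differentiates it. The last clause fixes the derivative at 0,
    which makes the submanifold tangent to [E]. *)
Lemma local_inverse (V : completeNormedModType R) (h : V -> V) (sigma : R) :
  0 < sigma -> h 0 = 0 ->
  (forall x y, `|x| <= sigma -> `|y| <= sigma ->
    `|h x - h y - (x - y)| <= 2^-1 * `|x - y|) ->
  (forall x, `|x| <= sigma -> exists L, strict_diff h x L) ->
  exists g : V -> V, [/\
    forall y, `|y| < sigma / 2 -> `|g y| <= sigma /\ h (g y) = y,
    forall y, `|y| < sigma / 2 ->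
      exists2 L', strict_diff g y L' & injective L'
  & strict_diff h 0 id -> strict_diff g 0 id].
Proof.
move=> s0 h0 hlip hL.
have s20 : 0 < sigma / 2 by rewrite divr_gt0.
have /choice[g gP] y : exists x, `|y| < sigma / 2 -> `|x| <= sigma /\ h x = y.
  have [ys|_] := ltP `|y| (sigma / 2); last by exists 0.
  have [||||x xs xy] := @picard _ V (fun v => h v - v) sigma y.
  - exact: ltW.
  - by rewrite h0 subrr.
  - by move=> u v us vs; rewrite subrACA; exact: hlip.
  - exact: ltW.
  - by exists x => _; split => //; rewrite -xy addrC subrK.
have glip u v : `|u| < sigma / 2 -> `|v| < sigma / 2 -> `|g u - g v| <= 2 * `|u - v|.
  move=> us vs; have [gu hgu] := gP _ us; have [gv hgv] := gP _ vs.
  by apply: near_id_lower; have := hlip _ _ gu gv; rewrite hgu hgv.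
have n0 : `|0 : V| < sigma / 2 by rewrite normr0.
have g0 : g 0 = 0.
  have [gs hg0] := gP _ n0; apply/eqP; rewrite -normr_le0.
  have zs : `|0 : V| <= sigma by rewrite normr0 ltW.
  have := hlip _ _ gs zs; rewrite hg0 h0 subrr sub0r normrN subr0.
  have := normr_ge0 (g 0); lra.
have strictg y L L' : `|y| < sigma / 2 -> strict_diff h (g y) L ->
    bounded_linear L' -> cancel L L' -> strict_diff g y L'.
  move=> ys hy bL' LK.
  have r0 : 0 < sigma / 2 - `|y| by rewrite subr_gt0.
  have near u : `|u - y| < sigma / 2 - `|y| -> `|u| < sigma / 2.
    by rewrite ltrBrDr => /(le_lt_trans (ler_normD _ _)); rewrite subrK.
  apply: (strict_diff_inverse r0 (ltr0n _ 2) hy bL' LK).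
    by move=> u /near/gP[].
  by move=> u v /near us /near vs; exact: glip.
exists g; split => //.
- move=> y ys; have [gys hgy] := gP _ ys; have [L hyL] := hL _ gys.
  (* The strict inequality leaves a ball around [g y] on which [hlip] is available. *)
  have gy : `|g y| < sigma.
    have := glip _ _ ys n0; rewrite g0 !subr0 => gy; lra.
  have d0 : 0 < sigma - `|g y| by rewrite subr_gt0.
  have L12 v : `|L v - v| <= 2^-1 * `|v|.
    apply: (strict_diff_near_id hyL d0) => u w us ws.
    have near x : `|x - g y| < sigma - `|g y| -> `|x| <= sigma.
      rewrite ltrBrDr => /(le_lt_trans (ler_normD _ _)).
      by rewrite subrK => /ltW.
    by apply: hlip; exact: near.
  have [L' [bL' LK L'K]] := near_id_inverse hyL.1 L12.
  exists L'; first exact: strictg hyL bL' LK.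
  exact: can_inj L'K.
- move=> hid; apply: (strictg 0 id id) => //; first by rewrite g0.
  exact: hid.1.
Qed.

End LocalInverse.

Section ColumnVectors.
Context {R : realType}.

Lemma le_mx_norm (m n : nat) (M : 'M[R]_(m, n)) i j : `|M i j| <= `|M|.
Proof.
rewrite [leRHS]/Num.norm /= mx_normrE.
by apply: (le_bigmax_cond _ (fun ij => `|M ij.1 ij.2|) (j := (i, j))).
Qed.

Lemma mx_norm_le (m n : nat) (M : 'M[R]_(m, n)) (c : R) : 0 <= c ->
  (forall i j, `|M i j| <= c) -> `|M| <= c.
Proof.
move=> c0 Mc; rewrite [leLHS]/Num.norm /= mx_normrE.
by apply: bigmax_le => // -[i j] _; exact: Mc.
Qed.

Lemma linear_cV_bounded (V : normedModType R) d (T : {linear 'cV[R]_d -> V}) :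
  bounded_linear T.
Proof.
split; first exact: linearP.
exists (\sum_j `|T (delta_mx j 0)|); first exact: sumr_ge0.
move=> z; rewrite {1}(matrix_sum_delta z).
under eq_bigr do rewrite big_ord1.
rewrite linear_sum (le_trans (ler_norm_sum _ _ _))// mulr_suml ler_sum// => j _.
by rewrite linearZ normrZ mulrC ler_wpM2l// le_mx_norm.
Qed.

End ColumnVectors.

(** * Boundedness of the projections of the splitting *)

Section Projections.
Context {R : realType} (B : normedModType R).

Lemma dist_to_lip (F : set B) x y : F !=set0 -> dist_to F x <= dist_to F y + `|x - y|.
Proof.
move=> [p Fp]; rewrite -lerBlDr; apply: lb_le_inf; first by exists `|y - p|, p.
move=> _ [q Fq <-]; rewrite lerBlDr.
apply: (@le_trans _ _ `|x - q|).
  apply: ge_inf; last by exists q.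
  by exists 0 => _ [? _ <-].
by rewrite [leRHS]addrC (le_trans _ (ler_normD _ _))// subrKA.
Qed.

Lemma dist_to_ge0 (F : set B) x : F !=set0 -> 0 <= dist_to F x.
Proof.
by move=> [p Fp]; apply: lb_le_inf; [exists `|x - p|, p|move=> _ [? _ <-]].
Qed.

(** The distance from [T z] to the closed subspace [F] is continuous in [z] and nonzero on the unit
    sphere, since [E] and [F] meet only in 0; by compactness it stays away from 0 there. Scaling
    covers all [z]. *)
Lemma complement_lower_bound (E F : set B) d (T : {linear 'cV[R]_d -> B}) :
  is_direct_sum E F -> closed F -> injective T -> range T = E ->
  exists2 c : R, 0 < c & forall z p, F p -> c * `|z| <= `|T z + p|.
Proof.
move=> [_ [F0 Fsub] EF _] cF injT rT.
(* Row vectors are the form in which [bounded_closed_compact] is applied; hence the transposes. *)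
pose S := [set v : 'rV[R]_d | `|v| = 1].
pose g (v : 'rV[R]_d) := dist_to F (T v^T).
have [_ [M M0 TM]] := linear_cV_bounded T.
have Fne : F !=set0 by exists 0.
have normT (v : 'rV[R]_d) : `|v^T| <= `|v|.
  by apply: mx_norm_le => // i j; rewrite mxE le_mx_norm.
have normT' (v : 'cV[R]_d) : `|v| <= `|v^T|.
  by apply: mx_norm_le => // i j; have := le_mx_norm v^T j i; rewrite mxE.
have gc : continuous g.
  move=> v; apply/(@cvgrPdist_le _ _ _ (nbhs v)) => e e0.
  have M1 : 0 < M + 1 by exact: ltr_wpDl.
  apply: filterS (nbhsx_ballx v _ (divr_gt0 e0 M1)) => w.
  rewrite mx_norm_ball /ball_ /= ltr_pdivlMr// => vw.
  have H : `|T v^T - T w^T| <= e.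
    rewrite -linearB -linearB (le_trans (TM _))// (le_trans (ler_wpM2l M0 (normT _)))//.
    by rewrite (le_trans _ (ltW vw))// mulrC ler_wpM2l// lerDl.
  have H' : `|T w^T - T v^T| <= e by rewrite distrC.
  have D1 := dist_to_lip (T v^T) (T w^T) Fne.
  have D2 := dist_to_lip (T w^T) (T v^T) Fne.
  by rewrite ler_norml /g; apply/andP; split; lra.
have cS : compact S.
  apply: bounded_closed_compact.
    exists 1; split => // x x1 v /= ->; exact: ltW.
  have -> : S = Num.norm @^-1` [set (1 : R)] by [].
  apply: preimage_closed; last exact: closed_eq.
  by move=> v _; exact: norm_continuous.
have cI : closed (g @` S).
  apply: compact_closed; first exact: norm_hausdorff.
  by apply: continuous_compact => //; exact: continuous_subspaceT.
have n0 : (~` (g @` S)) 0.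
  move=> [v v1 gv].
  have : F (T v^T).
    apply: contrapT => nF; have oF : open (~` F) by exact: closed_openC.
    have [r r0 rF] := open_ball oF nF.
    suff : r <= g v by rewrite gv leNgt r0.
    apply: lb_le_inf; first by case: Fne => p Fp; exists `|T v^T - p|, p.
    move=> _ [p Fp <-]; rewrite leNgt; apply/negP => pr.
    by apply: (rF p) => //; rewrite distrC.
  move=> FT; have : (E `&` F) (T v^T) by split => //; rewrite -rT; exists v^T.
  rewrite EF /= -(linear0 T) => /injT /(congr1 trmx); rewrite trmxK trmx0 => v0.
  by move: v1; rewrite /S /= v0 normr0 => /eqP; rewrite eq_sym oner_eq0.
have [c c0 cP] := open_ball (closed_openC cI) n0.
exists c => // z p Fp; have [->|z0] := eqVneq z 0.
  by rewrite normr0 mulr0.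
have nz0 : 0 < `|z^T|.
  by rewrite (lt_le_trans _ (normT' z))// normr_gt0.
have cz : c <= g (`|z^T|^-1 *: z^T).
  rewrite leNgt; apply/negP => gc'; apply: (cP (g (`|z^T|^-1 *: z^T))).
    by rewrite subr0 ger0_norm// /g dist_to_ge0.
  exists (`|z^T|^-1 *: z^T) => //.
  by rewrite /S /= normrZ gtr0_norm ?invr_gt0// mulVf// gt_eqF.
have Fz : F (- (`|z^T|^-1 *: p)).
  by have := Fsub (- `|z^T|^-1) p 0 Fp F0; rewrite addr0 scaleNr.
have : g (`|z^T|^-1 *: z^T) <= `|z^T|^-1 * `|T z + p|.
  apply: (@le_trans _ _ `|T (`|z^T|^-1 *: z^T)^T - - (`|z^T|^-1 *: p)|).
    apply: ge_inf; last by exists (- (`|z^T|^-1 *: p)).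
    by exists 0 => _ [? _ <-].
  rewrite opprK linearZ/= trmxK linearZ/= -scalerDr normrZ gtr0_norm ?invr_gt0//.
move=> /(le_trans cz); rewrite mulrC ler_pdivlMr// => H.
by rewrite (le_trans _ H)// ler_wpM2l ?(ltW c0).
Qed.

(** [PE] and [PF] are given merely as functions that decompose each vector. Uniqueness of the
    decomposition makes them linear, and [complement_lower_bound] makes them bounded. *)
Lemma splitting_projections_bounded (E F : set B) d (T : {linear 'cV[R]_d -> B})
    (PE : B -> 'cV[R]_d) (PF : B -> B) :
  is_direct_sum E F -> closed F -> injective T -> range T = E ->
  splitting_projections F T PE PF ->
  [/\ bounded_linear PE, bounded_linear PF, forall z, PE (T z) = z,
    forall z, PF (T z) = 0 & forall p, F p -> PE p = 0].
Proof.
move=> dEF cF injT rT sP; have [_ [F0 Fsub] _ _] := dEF.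
have [c c0 cP] := complement_lower_bound dEF cF injT rT.
have uniq z z' p p' : F p -> F p' -> T z + p = T z' + p' -> z = z' /\ p = p'.
  move=> Fp Fp' eq; have Fd : F (p - p').
    by rewrite addrC -scaleN1r; exact: Fsub.
  have : c * `|z - z'| <= 0.
    rewrite (le_trans (cP _ _ Fd))// linearB addrACA eq addrACA.
    by rewrite !subrr addr0 normr0.
  rewrite pmulr_rle0// normr_le0 subr_eq0 => /eqP zz; split => //.
  by move: eq; rewrite zz => /addrI.
have lin k u v : PE (k *: u + v) = k *: PE u + PE v /\
    PF (k *: u + v) = k *: PF u + PF v.
  have [Fu uE] := sP u; have [Fv vE] := sP v; have [Fw wE] := sP (k *: u + v).
  apply: uniq => //; first exact: Fsub.
  by rewrite -wE linearD linearZ/= addrACA -scalerDr -uE -vE.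
have bPE : bounded_linear PE.
  split; first by move=> k u v; have [] := lin k u v.
  exists c^-1; first by rewrite invr_ge0 ltW.
  move=> v; have [Fv vE] := sP v; rewrite [leRHS]mulrC ler_pdivlMr// mulrC.
  by rewrite [X in _ <= `|X|]vE cP.
have [_ [M M0 PM]] := bPE; have [_ [M' M'0 TM]] := linear_cV_bounded T.
split => //.
- split; first by move=> k u v; have [] := lin k u v.
  exists (1 + M' * M); first by rewrite addr_ge0// mulr_ge0.
  move=> v; have [Fv vE] := sP v.
  have -> : PF v = v - T (PE v) by rewrite [X in _ = X - _]vE addrAC subrr add0r.
  rewrite (le_trans (ler_normB _ _))// mulrDl mul1r lerD2l.
  by rewrite (le_trans (TM _))// -mulrA ler_wpM2l.
- move=> z; have [Fz zE] := sP (T z).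
  by have [] := @uniq (PE (T z)) z (PF (T z)) 0 Fz F0; rewrite -?zE ?addr0.
- move=> z; have [Fz zE] := sP (T z).
  by have [] := @uniq (PE (T z)) z (PF (T z)) 0 Fz F0; rewrite -?zE ?addr0.
- move=> p Fp; have [Fp' pE] := sP p.
  by have [] := @uniq (PE p) 0 (PF p) p Fp' Fp; rewrite -?pE ?linear0 ?add0r.
Qed.

End Projections.

(** * The spectral submanifold *)

Section SpectralSubmanifold.
Context {R : realType}.

Lemma strict_diff_for_continuous (V W : normedModType R) (g : V -> W) x L :
  strict_diff g x L -> {for x, continuous g}.
Proof. by move=> /strict_diff_differentiable[dg _]; exact: differentiable_continuous. Qed.

(** The radius [s] is so small that [C s^alpha <= 1/2], as local inversion requires; the same choice
    with an arbitrary [e] in place of 1/2 shows that [h] has derivative [id] at 0. *)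
Lemma local_linearization (B : completeNormedModType R) (U : set B)
    (A Ainv : {linear B -> B}) (ft : B -> B) (alpha : R) :
  let f := fun x : B => A x + ft x in
  (exists v : B, v != 0) -> open U -> U 0 ->
  continuous A -> continuous Ainv -> cancel A Ainv -> cancel Ainv A ->
  ft 0 = 0 -> (forall v : B, 'd ft (0 : B) v = 0) ->
  0 < alpha -> alpha_contracting alpha A Ainv -> C1_holder_on alpha U ft ->
  exists a N (h : B -> B) (s : R), [/\ 0 < a < 1, 0 < s, adapted_norm A a N,
     forall x, N x < s -> U x /\ N (f x) < s & [/\ h 0 = 0,
     strict_diff h 0 id,
     forall x, N x < s -> h (f x) = A (h x),
     forall x, N x < s -> exists L, strict_diff h x L
   & forall x y, N x < s -> N y < s ->
       `|h x - h y - (x - y)| <= 2^-1 * `|x - y|]].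
Proof.
move=> f nt oU U0 cA cAi AK AiK ft0 dft0 al0 cAA ftH.
have bA := continuous_bounded_linear cA.
have bAi := continuous_bounded_linear cAi.
have [a [b [NA [NB [[a01 b0 ab1] [a0 /andP[a00 a0a] [aNA aNB]]]]]]] :=
  contracting_adapted nt bA bAi AK al0 cAA.
have [a_gt0 a1] := andP a01.
have [r r0 rU] := open_ball oU U0.
have [K K0 Kft] := holder_lip al0 ftH U0 rU.
have ftK s y z : s <= r -> `|y| < s -> `|z| < s ->
    `|ft y - ft z| <= K * s `^ alpha * `|y - z|.
  move=> sr ys zs; have := Kft s y z sr.
  by rewrite !subr0 dft0 subr0; exact.
have rU' y : `|y| < r -> U y by move=> yr; apply: rU; rewrite subr0.
have ftS y : `|y| < r -> exists L, strict_diff ft y L.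
  by move=> /rU' Uy; exists ('d ft y); exact: (holder_strict_diff al0 ftH oU Uy).
have [rho [rho0 rhor fN]] :=
  contraction_radius bA al0 a0a aNA r0 K0 ftK.
have [h [hf h0 hS [C C0 hC]]] := linearizing_conjugacy bA bAi AK AiK
  a00 a0a a1 b0 ab1 aNA aNB K0 ft0 ftK ftS rho0 rhor fN.
have [_ _ N1 NT [c c0 Nc]] := aNA.
have half0 : 0 < 2^-1 :> R by rewrite invr_gt0.
have [s1 s10 Cs1] := powR_small C0 half0 al0.
have small e : 0 < e -> exists2 s, 0 < s <= rho & forall x y, NA x < s -> NA y < s ->
    `|h x - h y - (x - y)| <= e * `|x - y|.
  move=> e0; have [t t0 Ct] := powR_small C0 e0 al0.
  have m0 : 0 < Num.min t rho by rewrite lt_min t0.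
  exists (Num.min t rho); first by rewrite m0 ge_min lexx orbT.
  move=> x y xs ys.
  have mr : Num.min t rho <= rho by rewrite ge_min lexx orbT.
  rewrite (le_trans (hC _ _ _ m0 mr xs ys))// ler_wpM2r// (le_trans _ Ct)//.
  rewrite ler_wpM2l//; apply: ge0_ler_powR; rewrite ?nnegrE ?(ltW al0) ?(ltW m0)//.
    exact: ltW.
  by rewrite ge_min lexx.
have [s /andP[s0 srho] hs] := small _ half0.
exists a, NA, h, s; split => //.
- have [N2 N3 _ _ N5] := aNA; split => //.
  move=> x; rewrite (le_trans (NT x))// ler_wpM2r ?(adapted_norm_ge0 _ aNA)//.
  exact: ltW.
- move=> x xs; split.
    apply: rU'; apply: le_lt_trans (N1 _) _; apply: (lt_le_trans xs).
    exact: le_trans rhor.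
  have := adapted_ball_invariant bA a00 a0a aNA ft0 rho0 fN srho xs.
  by move=> /lt_le_trans; apply; rewrite ler_piMl ?(ltW s0) ?(ltW a1).
split => //.
- split; first by split; [move=> k u v|exists 1 => // v; rewrite mul1r].
  move=> e e0; have [t /andP[t0 _] ht] := small _ e0.
  exists (t / c); first exact: divr_gt0.
  move=> y z; rewrite !subr0 !ltr_pdivlMr// => yt zt.
  by apply: ht; rewrite (le_lt_trans (Nc _))// mulrC.
- by move=> x xs; apply: hf; exact: lt_le_trans srho.
- by move=> x xs; apply: hS; exact: lt_le_trans srho.
Qed.

Lemma spectral_submanifold (B : completeNormedModType R) (U : set B)
    (A Ainv : {linear B -> B}) (ft : B -> B) (alpha : R) (d : nat)
    (E F : set B) (TE : {linear 'cV[R]_d -> B}) (LE : 'M[R]_d)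
    (PE : B -> 'cV[R]_d) (PF : B -> B) :
  let f := fun x : B => A x + ft x in
  open U -> U 0 ->
  continuous A -> continuous Ainv -> cancel A Ainv -> cancel Ainv A ->
  ft 0 = 0 -> (forall v : B, 'd ft (0 : B) v = 0) ->
  0 < alpha -> alpha_contracting alpha A Ainv -> C1_holder_on alpha U ft ->
  (0 < d)%N -> is_direct_sum E F -> closed F ->
  injective TE -> range TE = E -> (forall z, A (TE z) = TE (LE *m z)) ->
  splitting_projections F TE PE PF ->
  exists (W : set B) (Omega : set 'cV[R]_d) (w : 'cV[R]_d -> B),
    attracting_ssm U f E W Omega w (mulmx LE) /\
    (forall z, 'd w (0 : 'cV[R]_d) z = TE z).
Proof.
move=> f oU U0 cA cAi AK AiK ft0 dft0 al0 cAA ftH d0 dEF cF injT rT AT sP.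
have nt : exists v : B, v != 0.
  exists (TE (const_mx 1)); rewrite -(linear0 TE) (inj_eq injT).
  apply/eqP => /matrixP/(_ (Ordinal d0) 0)/eqP.
  by rewrite !mxE oner_eq0.
have [a [N [h [s [a01 s0 aN NU [h0 hid hf hS hs]]]]]] :=
  local_linearization nt oU U0 cA cAi AK AiK ft0 dft0 al0 cAA ftH.
have [bPE bPF PET PFT _] := splitting_projections_bounded dEF cF injT rT sP.
have bT := linear_cV_bounded TE.
have [_ [KE KE0 PEK]] := bPE; have [_ [KF KF0 PFK]] := bPF.
have [_ [KT KT0 TK]] := bT.
have [ND NN N1 NT [c c0 Nc]] := aN.
have [a_gt0 a1] := andP a01.
have bA := continuous_bounded_linear cA.
pose sigma := s / (2 * c).
have sig0 : 0 < sigma by rewrite divr_gt0// mulr_gt0.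
have sigs x : `|x| <= sigma -> N x < s.
  move=> xs; rewrite (le_lt_trans (Nc _))//.
  have : c * `|x| <= c * sigma by rewrite ler_wpM2l// ltW.
  have -> : c * sigma = s / 2 by rewrite /sigma; field; rewrite gt_eqF.
  lra.
have [||g [gP gS gid]] := local_inverse sig0 h0.
- by move=> x y xs ys; apply: hs; exact: sigs.
- by move=> x xs; apply: hS; exact: sigs.
have lower x y : N x < s -> N y < s -> `|x - y| <= 2 * `|h x - h y|.
  by move=> xs ys; apply: near_id_lower; exact: hs.
have upper x y : N x < s -> N y < s -> `|h x - h y| <= 2 * `|x - y|.
  move=> xs ys; have := hs _ _ xs ys.
  have := ler_normD (h x - h y - (x - y)) (x - y); rewrite subrK.
  have := normr_ge0 (x - y); lra.
(* The ball is taken in the adapted norm, in which [A] contracts, so that [Omega] is invariant under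
   [LE]. *)
pose Omega := [set z : 'cV[R]_d | N (TE z) < sigma / 2].
pose w := g \o TE.
have OT z : Omega z -> `|TE z| < sigma / 2 by exact: le_lt_trans.
have wN z : Omega z -> N (w z) < s by move=> /OT/gP[/sigs].
have hw z : Omega z -> h (w z) = TE z by move=> /OT/gP[].
have N0 := adapted_norm0 aN.
have Nge0 x : 0 <= N x by exact: adapted_norm_ge0 aN.
have s20 : 0 < sigma / 2 by rewrite divr_gt0.
have O0 : Omega 0 by rewrite /Omega /= linear0 N0.
have n0s : N 0 < s by rewrite N0.
have w0 : w 0 = 0.
  have := lower (w 0) 0 (wN _ O0) n0s.
  by rewrite hw// h0 linear0 !subr0 normr0 mulr0 normr_le0 => /eqP.
have OL z : Omega z -> Omega (LE *m z).
  rewrite /Omega /= -AT; apply: le_lt_trans.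
  by rewrite (le_trans (NT _))// ler_piMl// ltW.
(* Both sides have the same image under [h], which is injective on [N x < s] by [lower]. *)
have wL z : Omega z -> f (w z) = w (LE *m z).
  move=> Oz; have [_ fN] := NU _ (wN _ Oz).
  apply/eqP; rewrite -subr_eq0 -normr_le0.
  rewrite (le_trans (lower _ _ fN (wN _ (OL _ Oz))))//.
  by rewrite hf ?wN// (hw _ Oz) (hw _ (OL _ Oz)) AT subrr normr0 mulr0.
have wS z : Omega z -> exists2 L, strict_diff w z L & injective L.
  move=> Oz; have [L' gL' injL'] := gS _ (OT _ Oz).
  exists (L' \o TE); last exact: inj_comp.
  by apply: strict_diff_comp gL'; exact: strict_diff_linear.
have w0S : strict_diff w 0 TE.
  apply: (@strict_diff_comp _ _ _ _ TE g 0 TE id).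
    exact: strict_diff_linear.
  by rewrite linear0; exact: gid.
have [_ dw0] := strict_diff_differentiable w0S.
exists (w @` Omega), Omega, w; split; last by move=> z; rewrite dw0.
have oO : open Omega.
  rewrite openE => z Oz; rewrite /interior.
  have [e e0 eN] := adapted_norm_open aN Oz.
  have K1 : 0 < KT + 1 by exact: ltr_wpDl.
  apply: filterS (nbhsx_ballx z _ (divr_gt0 e0 K1)) => y.
  rewrite mx_norm_ball /ball_ /= ltr_pdivlMr// => zy.
  apply: eN; rewrite -linearB (le_lt_trans (TK _))// (le_lt_trans _ zy)//.
  by rewrite distrC mulrC ler_wpM2l// lerDl.
split.
- by split.
- by split=> // _ [z Oz <-]; have [] := NU _ (wN _ Oz).
- by apply: strict_diff_C1 => // z /wS[L wL' _]; exists L.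
- move=> z /wS[L wL' injL]; have [_ ->] := strict_diff_differentiable wL'.
  exact: injL.
(* [h] maps the manifold into [E], where [PE] reads off the parameter. *)
- exists (PE \o h); split; first by move=> z Oz; rewrite /= hw.
  apply: continuous_in_subspaceT => x; rewrite inE => -[z Oz <-].
  have [L hL] := hS _ (wN _ Oz).
  by apply: (strict_diff_for_continuous (strict_diff_comp hL (strict_diff_linear _ bPE))).
- exact: w0.
- by rewrite dw0.
- by move=> z Oz; split; [exact: OL|exact: wL].
- apply: strict_diff_C1 => // z _; exists (mulmx LE).
  exact/strict_diff_linear/linear_cV_bounded.
- have fU n x : N x < s -> N (iter n f x) < s.
    by move=> xs; elim: n => // n /NU[].
  have hfn n x : N x < s -> h (iter n f x) = iter n A (h x).
    by move=> xs; elim: n => //= n IH; rewrite hf ?fU// IH.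
  have OLn n z : Omega z -> Omega (iter n (mulmx LE) z).
    by move=> Oz; elim: n => //= n; exact: OL.
  have ALn n z : TE (iter n (mulmx LE) z) = iter n A (TE z).
    by elim: n => //= n IH; rewrite -AT IH.
  (* The orbit of [x] is compared with the orbit on the manifold that starts at the parameter
     [PE (h x)], which must therefore lie in [Omega]. *)
  exists [set x | N x < s /\ Omega (PE (h x))], (2 * c * (2 * KF)), a; split.
  + have [e1 e10 eN] := adapted_norm_open aN n0s.
    have K1 : 0 < c * KT * KE * 2 + 1 by rewrite ltr_wpDl// !mulr_ge0// ltW.
    have m0 : 0 < Num.min e1 (sigma / 2 / (c * KT * KE * 2 + 1)).
      by rewrite lt_min e10 divr_gt0.
    apply: filterS (nbhsx_ballx (0 : B) _ m0) => x.
    rewrite -ball_normE /ball_ /= sub0r normrN lt_min ltr_pdivlMr// => /andP[x1 x2].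
    have xs : N x < s by apply: eN; rewrite subr0.
    split => //.
    have hx : `|h x| <= 2 * `|x| by have := upper x 0 xs n0s; rewrite h0 !subr0.
    rewrite /Omega /= (le_lt_trans (Nc _))// (le_lt_trans _ x2)//.
    rewrite (le_trans (ler_wpM2l (ltW c0) (TK _)))//.
    rewrite (le_trans (ler_wpM2l (ltW c0) (ler_wpM2l KT0 (PEK _))))//.
    rewrite (le_trans (ler_wpM2l (ltW c0) (ler_wpM2l KT0 (ler_wpM2l KE0 hx))))//.
    rewrite mulrDr mulr1 -[leLHS]addr0 lerD// le_eqVlt; apply/orP; left; apply/eqP; ring.
  + by rewrite (ltW a_gt0) a1.
  + move=> x [xs Oz] n; have [Ufn _] := NU _ (fU n _ xs); split => //.
    set z := PE (h x) in Oz.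
    have [Fp hE] := sP (h x).
    have an0 : 0 <= a ^+ n by rewrite exprn_ge0// ltW.
    (* After applying [h], the two orbits differ by [A^n (PF (h x))], which decays like [a ^+ n]. *)
    have D1 : dist_to (w @` Omega) (iter n f x) <= 2 * c * a ^+ n * `|PF (h x)|.
      apply: (@le_trans _ _ `|iter n f x - w (iter n (mulmx LE) z)|).
        apply: ge_inf; first by exists 0 => _ [? _ <-].
        exists (w (iter n (mulmx LE) z)) => //.
        by exists (iter n (mulmx LE) z) => //; exact: OLn.
      rewrite (le_trans (lower _ _ (fU n _ xs) (wN _ (OLn n _ Oz))))//.
      rewrite hfn// hw; last exact: OLn.
      have bAn := bounded_linear_iter n bA.
      rewrite ALn -(bounded_linearB _ _ bAn).
      have -> : h x - TE z = PF (h x) by rewrite [X in X - _]hE addrAC subrr add0r.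
      rewrite -!mulrA ler_pM2l// (le_trans (N1 _))//.
      rewrite (le_trans (adapted_norm_iter _ _ (ltW a_gt0) aN))//.
      by rewrite mulrCA ler_wpM2l.
    (* [PF] vanishes at [h (w y)], so [PF (h x)] is controlled by the distance from [x] to any
       [w y]. *)
    have D2 : `|PF (h x)| <= 2 * KF * dist_to (w @` Omega) x.
      have [KF00|KF00] := eqVneq KF 0.
        by rewrite (le_trans (PFK _))// KF00 mul0r mulr0 mul0r.
      have KFp : 0 < 2 * KF by rewrite mulr_gt0// lt_neqAle eq_sym KF00.
      rewrite mulrC -ler_pdivrMr//; apply: lb_le_inf.
        by exists `|x - w 0|, (w 0) => //; exists 0.
      move=> _ [_ [y Oy <-] <-]; rewrite ler_pdivrMr//.
      have -> : PF (h x) = PF (h x - h (w y)).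
        by rewrite (bounded_linearB _ _ bPF) hw// PFT subr0.
      rewrite (le_trans (PFK _))// (le_trans (ler_wpM2l KF0 (upper _ _ xs (wN _ Oy))))//.
      by rewrite le_eqVlt; apply/orP; left; apply/eqP; ring.
    rewrite (le_trans D1)// (le_trans (ler_wpM2l _ D2))//.
      by rewrite !mulr_ge0// ltW.
    by rewrite le_eqVlt; apply/orP; left; apply/eqP; ring.
Qed.

End SpectralSubmanifold.

(** * The DMD estimate *)

Section EuclideanNorm.
Context {R : realType}.

(** Lagrange's identity: the right side minus the left is half the double sum of
    [(x i * y j - x j * y i) ^+ 2]. *)
Lemma cauchy_schwarz_sum (I : finType) (x y : I -> R) :
  (\sum_i x i * y i) ^+ 2 <= (\sum_i x i ^+ 2) * (\sum_i y i ^+ 2).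
Proof.
have : 0 <= \sum_i \sum_j (x i * y j - x j * y i) ^+ 2.
  by apply: sumr_ge0 => i _; apply: sumr_ge0 => j _; exact: sqr_ge0.
have -> : \sum_i \sum_j (x i * y j - x j * y i) ^+ 2 =
    \sum_i \sum_j (x i ^+ 2 * y j ^+ 2) + \sum_i \sum_j (x j ^+ 2 * y i ^+ 2)
    - 2 * \sum_i \sum_j ((x i * y i) * (x j * y j)).
  rewrite mulr_sumr -big_split -sumrB /=; apply: eq_bigr => i _.
  by rewrite mulr_sumr -big_split -sumrB /=; apply: eq_bigr => j _; ring.
rewrite [X in _ + X - _]exchange_big /= -!big_distrlr /= expr2; lra.
Qed.

Lemma euclid_norm_sqr m n (M : 'M[R]_(m, n)) :
  euclid_norm M ^+ 2 = \sum_i \sum_j M i j ^+ 2.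
Proof.
rewrite sqr_sqrtr//; apply: sumr_ge0 => i _.
by apply: sumr_ge0 => j _; exact: sqr_ge0.
Qed.

Lemma euclid_norm_ge0 m n (M : 'M[R]_(m, n)) : 0 <= euclid_norm M.
Proof. exact: sqrtr_ge0. Qed.

Lemma tuple_norm_ge0 (V : normedModType R) m (X : 'I_m -> V) : 0 <= tuple_norm X.
Proof. exact: sqrtr_ge0. Qed.

Lemma tuple_norm_sqr (V : normedModType R) m (X : 'I_m -> V) :
  tuple_norm X ^+ 2 = \sum_i `|X i| ^+ 2.
Proof. by rewrite sqr_sqrtr//; apply: sumr_ge0 => i _; exact: sqr_ge0. Qed.

Lemma le_tuple_norm (V : normedModType R) m (X : 'I_m -> V) i : `|X i| <= tuple_norm X.
Proof.
rewrite -(ler_pXn2r (ltn0Sn 1)) ?nnegrE ?tuple_norm_ge0// tuple_norm_sqr.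
by rewrite (bigD1 i)//= lerDl; apply: sumr_ge0 => j _; exact: sqr_ge0.
Qed.

Lemma euclid_norm_mulmx m n p (M : 'M[R]_(m, n)) (N : 'M[R]_(n, p)) :
  euclid_norm (M *m N) <= euclid_norm M * euclid_norm N.
Proof.
rewrite -(ler_pXn2r (ltn0Sn 1)) ?nnegrE ?mulr_ge0 ?euclid_norm_ge0//.
rewrite exprMn !euclid_norm_sqr [X in _ <= _ * X]exchange_big /= mulr_suml.
apply: ler_sum => i _; rewrite mulr_sumr; apply: ler_sum => j _.
by rewrite mxE; exact: cauchy_schwarz_sum.
Qed.

End EuclideanNorm.

(** * The Moore-Penrose inverse of a matrix of full row rank *)

Section PseudoInverse.
Context {R : realType}.

(** If [v] annihilates the Gram matrix, the sum of the squared entries of [v *m M] is 0; so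
    [v *m M = 0], and full row rank gives [v = 0]. *)
Lemma row_free_gram_unit m n (M : 'M[R]_(m, n)) : row_free M -> M *m M^T \in unitmx.
Proof.
move=> fM; rewrite -row_free_unit -kermx_eq0; apply/eqP/row_matrixP => i.
rewrite row0; set v := row i _.
have vG : v *m (M *m M^T) = 0 by apply/sub_kermxP; exact: row_sub.
apply: (row_free_inj fM); rewrite mul0mx; set u := v *m M.
have : u *m u^T = 0 by rewrite trmx_mul mulmxA -(mulmxA v) vG mul0mx.
clearbody u => /matrixP/(_ 0 0); rewrite !mxE => /eqP.
rewrite psumr_eq0 => [/allP z|j _]; last by rewrite mxE -expr2 sqr_ge0.
apply/rowP => j; have := z j (mem_index_enum j).
by rewrite /= !mxE -expr2 sqrf_eq0 => /eqP.
Qed.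

(** [pseudo_inverse] is selected by [xget], so computing it takes uniqueness. Full row rank cancels
    [M] in [M P M = M], whence [M P = 1]; symmetry of [P M] gives [P = M^T (P^T P)], and multiplying
    by [M] identifies [P^T P] as the inverse Gram matrix. *)
Lemma moore_penrose_row_free m n (M : 'M[R]_(m, n)) (P : 'M[R]_(n, m)) :
  row_free M -> is_moore_penrose M P -> P = M^T *m invmx (M *m M^T).
Proof.
move=> fM [MPM PMP _ PMt]; have uG := row_free_gram_unit fM.
have MP1 : M *m P = 1%:M by apply: (row_free_inj fM); rewrite MPM mul1mx.
have PQ : P = M^T *m (P^T *m P) by rewrite mulmxA -trmx_mul PMt.
have : (M *m M^T) *m (P^T *m P) = 1%:M by rewrite -mulmxA -PQ.
move=> /(congr1 (mulmx (invmx (M *m M^T)))); rewrite mulKmx// mulmx1 => <-.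
exact: PQ.
Qed.

Lemma row_free_moore_penrose m n (M : 'M[R]_(m, n)) :
  row_free M -> is_moore_penrose M (M^T *m invmx (M *m M^T)).
Proof.
move=> fM; have uG := row_free_gram_unit fM.
have MP1 : M *m (M^T *m invmx (M *m M^T)) = 1%:M by rewrite mulmxA mulmxV.
split; first by rewrite MP1 mul1mx.
- by rewrite -mulmxA MP1 mulmx1.
- by rewrite MP1 trmx1.
- by rewrite !trmx_mul trmxK trmx_inv trmx_mul trmxK mulmxA.
Qed.

Lemma pseudo_inverseP m n (M : 'M[R]_(m, n)) :
  row_free M -> is_moore_penrose M (pseudo_inverse M).
Proof.
move=> fM; apply: (@xgetPex _ 0 [set P | is_moore_penrose M P]).
by exists (M^T *m invmx (M *m M^T)); exact: row_free_moore_penrose.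
Qed.

Lemma pseudo_inverse_row_free m n (M : 'M[R]_(m, n)) :
  row_free M -> pseudo_inverse M = M^T *m invmx (M *m M^T).
Proof. by move=> fM; exact: moore_penrose_row_free (pseudo_inverseP fM). Qed.

Lemma row_free_mul_pseudo_inverse m n (M : 'M[R]_(m, n)) :
  row_free M -> M *m pseudo_inverse M = 1%:M.
Proof.
move=> fM; rewrite pseudo_inverse_row_free// mulmxA mulmxV//.
exact: row_free_gram_unit.
Qed.

Lemma pseudo_inverse_unit n (M : 'M[R]_n) :
  M \in unitmx -> pseudo_inverse M = invmx M.
Proof.
move=> uM; rewrite -[LHS](mulKmx uM) row_free_mul_pseudo_inverse ?mulmx1//.
by rewrite row_free_unit.
Qed.

Lemma dmd_row_free d m (Phi Phihat : 'M[R]_(d, m)) : row_free Phi ->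
  dmd Phi Phihat = Phihat *m pseudo_inverse Phi.
Proof.
move=> fPhi; rewrite /dmd (pseudo_inverse_row_free fPhi).
by rewrite pseudo_inverse_unit ?row_free_gram_unit// mulmxA.
Qed.

Lemma dmd_sub d m (Phi Phihat : 'M[R]_(d, m)) (M0 : 'M[R]_d) : row_free Phi ->
  dmd Phi Phihat - M0 = (Phihat - M0 *m Phi) *m pseudo_inverse Phi.
Proof.
move=> fPhi; rewrite dmd_row_free// mulmxBl -mulmxA.
by rewrite row_free_mul_pseudo_inverse// mulmx1.
Qed.

End PseudoInverse.

(** * Taylor expansion of the observable, and norms of data matrices *)

Section Data.
Context {R : realType}.

(** Near 0 the derivative at [p] differs from that at 0 by at most [(1 + M) |p|]: [M] bounds [H 0],
    and 1 is the remainder at [e = 1]. [mean_value_sub] carries this along the segment to [y]. *)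
Lemma C2_quadratic (V W : normedModType R) (U : set V) (phi : V -> W) :
  open U -> U 0 -> C2_on U phi ->
  exists K r : R, [/\ 0 <= K, 0 < r & forall y, `|y| < r ->
    `|phi y - phi 0 - 'd phi 0 y| <= K * `|y| ^+ 2].
Proof.
move=> oU U0 [[dphi _] [H [bH HD _]]].
have [r1 r10 rU] := open_ball oU U0.
have /nbhs_normP[r2 /= r20 r2H] := HD 0 U0 1 ltr01.
have [_ HL [M' HM']] := bH 0 U0.
pose M := Num.max M' 0; have M0 : 0 <= M by rewrite le_max lexx orbT.
have HM v w : `|H 0 v w| <= M * `|v| * `|w|.
  by rewrite (le_trans (HM' _ _))// !ler_wpM2r// le_max lexx.
exists (1 + M), (Num.min r1 r2); split; first exact: addr_ge0.
- by rewrite lt_min r10.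
move=> y; rewrite lt_min => /andP[y1 y2].
have d0 : differentiable phi 0 by exact: dphi.
have b0 := diff_bounded_linear d0.
suff : `|phi y - phi 0 - 'd phi 0 (y - 0)| <= (1 + M) * `|y| ^+ 2.
  by rewrite subr0.
apply: mean_value_sub => // t /andP[t0 t1]; rewrite !add0r subr0.
set p := t *: y; have py : `|p| <= `|y| by rewrite normrZ ger0_norm// ler_piMl.
have dp : differentiable phi p.
  by apply: dphi; apply: rU; rewrite subr0 (le_lt_trans py).
split => //; have bp := diff_bounded_linear dp.
have bHp : bounded_linear (H 0 (p - 0)).
  split; first by move=> a u v; exact: HL.
  exists (M * `|p|); first exact: mulr_ge0.
  by move=> v; rewrite subr0.
have bD := bounded_linear_sub (bounded_linear_sub bp b0) bHp.
have p2 : `|0 - p| < r2 by rewrite sub0r normrN (le_lt_trans py).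
have := opnorm_le bD (r2H p p2) y.
rewrite subr0 mul1r => D1.
have D2 := HM p y.
rewrite -[X in `|X|](subrK (H 0 p y)) (le_trans (ler_normD _ _))//.
rewrite mulrDl mul1r lerD//.
  by rewrite (le_trans D1)// expr2 ler_wpM2r.
by rewrite (le_trans D2)// expr2 mulrA ler_wpM2r// ler_wpM2l.
Qed.

Lemma observable_jacobianE (V : normedModType R) d (phi : V -> 'cV[R]_d)
    (T : {linear 'cV[R]_d -> V}) z :
  observable_jacobian phi T *m z = 'd phi 0 (T z).
Proof.
rewrite {2}(matrix_sum_delta z); under [in RHS]eq_bigr do rewrite big_ord1.
rewrite !linear_sum; apply/matrixP => i j; rewrite !mxE summxE ord1.
by apply: eq_bigr => k _; rewrite !linearZ/= !mxE mulrC.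
Qed.

(** [M0 *m J = J *m LE], so the leading terms [J *m (LE *m PE x)] of [phi (f x)] and [M0 *m phi x]
    cancel. There remain the two [F] components, the nonlinearity [ft], and two quadratic
    remainders, which are absorbed using [|x|^2 <= |x|^(1 + alpha)] for [|x| < 1]. *)
Lemma observable_estimate (B : normedModType R) (U : set B) (A : {linear B -> B})
    (ft : B -> B) (alpha : R) (d : nat) (F : set B) (TE : {linear 'cV[R]_d -> B})
    (LE : 'M[R]_d) (PE : B -> 'cV[R]_d) (PF : B -> B) (phi : B -> 'cV[R]_d) :
  let f := fun x : B => A x + ft x in
  let J := observable_jacobian phi TE in
  let M0 := J *m LE *m invmx J in
  open U -> U 0 -> continuous A -> ft 0 = 0 -> (forall v : B, 'd ft (0 : B) v = 0) ->
  0 < alpha < 1 -> C1_holder_on alpha U ft ->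
  invariant_under A F -> (forall z, A (TE z) = TE (LE *m z)) ->
  splitting_projections F TE PE PF ->
  bounded_linear PE -> (forall z, PE (TE z) = z) -> (forall p, F p -> PE p = 0) ->
  C2_on U phi -> phi 0 = 0 -> \rank J = d ->
  exists C r : R, [/\ 0 <= C, 0 < r & forall x, `|x| < r ->
    `|phi (f x) - M0 *m phi x| <=
      C * (`|PF x| + `|PF (f x)| + `|x| `^ alpha * `|x|)].
Proof.
move=> f J M0 oU U0 cA ft0 dft0 /andP[al0 al1] ftH iF AT sP bPE PET PEF phi2 phi0 rJ.
have [Kp [rp [Kp0 rp0 phiK]]] := C2_quadratic oU U0 phi2.
have [r r0 rU] := open_ball oU U0.
have [K K0 Kft] := holder_lip al0 ftH U0 rU.
have bA := continuous_bounded_linear cA.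
have bD : bounded_linear ('d phi 0) by apply: diff_bounded_linear; exact: phi2.1.1.
have [_ [KA KA0 AK]] := bA; have [_ [KE KE0 PEK]] := bPE.
have [_ [KD KD0 DK]] := bD.
have [_ [KM KM0 MK]] := linear_cV_bounded (mulmx M0).
have [_ [KJ KJ0 JK]] := linear_cV_bounded (mulmx J).
pose k2 : R := 2 `^ alpha; have k20 : 0 <= k2 by exact: powR_ge0.
(* [Kft] asks for [|x|] strictly below the radius, so it is used at radius [2 |x|]; hence [r / 2]
   and [k2]. *)
have ftb x : `|x| < r / 2 -> `|ft x| <= K * k2 * (`|x| `^ alpha * `|x|).
  move=> xr; have [->|x0] := eqVneq x 0.
    by rewrite ft0 !normr0 !mulr0.
  have nx : 0 < `|x| by rewrite normr_gt0.
  have := Kft (2 * `|x|) x 0; rewrite subr0 subrr normr0 dft0 ft0 !subr0 => H.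
  rewrite (le_trans (H _ _ _))//; [lra|lra|exact: mulr_gt0|].
  by rewrite powRM// !mulrA.
pose KF := KA + K * k2.
have KF0 : 0 <= KF by rewrite addr_ge0// mulr_ge0.
pose C := KD + KM * KD + Kp * KF ^+ 2 + KJ * KE * K * k2 + KM * Kp.
have C0 : 0 <= C by rewrite /C !addr_ge0 ?mulr_ge0 ?sqr_ge0.
(* The bound 1 serves to compare powers of [|x|], [r / 2] serves [ft], and the last two put [x] and
   [f x] in the ball of the Taylor estimate. *)
pose r' := Num.min 1 (Num.min (r / 2) (Num.min rp (rp / (KF + 1)))).
have KF1 : 0 < KF + 1 by exact: ltr_wpDl.
exists C, r'; split => //; first by rewrite /r' !lt_min ltr01 !divr_gt0// rp0.
move=> x; rewrite /r' !lt_min => /and4P[x1 xr xp xp'].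
have xa : `|x| ^+ 2 <= `|x| `^ alpha * `|x|.
  have [->|x0] := eqVneq x 0; first by rewrite normr0 mulr0 expr0n.
  rewrite expr2 ler_wpM2r// ger1_powR// ?(ltW al1)//.
  by rewrite normr_gt0 x0 ltW.
have xa' : `|x| `^ alpha * `|x| <= `|x|.
  rewrite -[leRHS]mul1r ler_wpM2r//.
  have := @ge0_ler_powR R alpha (ltW al0) `|x| 1.
  by rewrite !nnegrE normr_ge0 ler01 powR1 => /(_ isT isT (ltW x1)).
set t := `|x| `^ alpha * `|x| in xa xa' *.
have t0 : 0 <= t by rewrite mulr_ge0// powR_ge0.
have ftx : `|ft x| <= K * k2 * t by exact: ftb.
have fx : `|f x| <= KF * `|x|.
  rewrite (le_trans (ler_normD _ _))// mulrDl lerD//.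
  by rewrite (le_trans ftx)// ler_wpM2l// mulr_ge0.
have fxp : `|f x| < rp.
  rewrite (le_lt_trans fx)//; move: xp'; rewrite ltr_pdivlMr//; apply: le_lt_trans.
  by rewrite mulrC ler_wpM2l// lerDl.
have uJ : J \in unitmx by rewrite -row_free_unit /row_free rJ.
have DE y : 'd phi 0 y = J *m PE y + 'd phi 0 (PF y).
  have [_ yE] := sP y; rewrite {1}yE (bounded_linearD _ _ bD).
  by rewrite observable_jacobianE.
have PEf : PE (f x) = LE *m PE x + PE (ft x).
  rewrite /f (bounded_linearD _ _ bPE); congr (_ + _).
  have [Fx xE] := sP x.
  by rewrite {1}xE linearD/= (bounded_linearD _ _ bPE) AT PET (PEF _ (iF _ Fx)) addr0.
pose q1 := phi (f x) - phi 0 - 'd phi 0 (f x).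
pose q2 := phi x - phi 0 - 'd phi 0 x.
have -> : phi (f x) - M0 *m phi x =
    q1 + 'd phi 0 (PF (f x)) + J *m PE (ft x) - M0 *m 'd phi 0 (PF x) - M0 *m q2.
  have -> : phi (f x) = q1 + (J *m (LE *m PE x) + J *m PE (ft x) + 'd phi 0 (PF (f x))).
    by rewrite -mulmxDr -PEf -DE /q1 phi0 subr0 subrK.
  have -> : M0 *m phi x = M0 *m q2 + (J *m (LE *m PE x) + M0 *m 'd phi 0 (PF x)).
    have -> : J *m (LE *m PE x) = M0 *m (J *m PE x).
      by rewrite /M0 -!mulmxA [invmx J *m _]mulmxA mulVmx// mul1mx.
    by rewrite -!mulmxDr -DE /q2 phi0 subr0 subrK.
  have cancel_common (q a b c q' e : 'cV[R]_d) :
      q + (a + b + c) - (q' + (a + e)) = q + c + b - e - q'.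
    rewrite -(addrA a) (addrCA q) (addrCA q') opprD addrACA subrr add0r.
    by rewrite opprD [b + c]addrC !addrA addrAC.
  exact: cancel_common.
have n1 : `|q1| <= Kp * KF ^+ 2 * t.
  rewrite (le_trans (phiK _ fxp))// -mulrA ler_wpM2l//.
  apply: (@le_trans _ _ ((KF * `|x|) ^+ 2)).
    by rewrite ler_pXn2r ?nnegrE// mulr_ge0.
  by rewrite exprMn ler_wpM2l// sqr_ge0.
have n2 : `|M0 *m q2| <= KM * Kp * t.
  rewrite (le_trans (MK _))// -mulrA ler_wpM2l// (le_trans (phiK _ xp))//.
  by rewrite ler_wpM2l.
have n3 : `|J *m PE (ft x)| <= KJ * KE * K * k2 * t.
  rewrite (le_trans (JK _))// -!mulrA ler_wpM2l// (le_trans (PEK _))//.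
  by rewrite ler_wpM2l// [leRHS]mulrA.
have n4 : `|'d phi 0 (PF (f x))| <= KD * `|PF (f x)| by exact: DK.
have n5 : `|M0 *m 'd phi 0 (PF x)| <= KM * KD * `|PF x|.
  by rewrite (le_trans (MK _))// -mulrA ler_wpM2l.
apply: (@le_trans _ _ (Kp * KF ^+ 2 * t + KD * `|PF (f x)| + KJ * KE * K * k2 * t
    + KM * KD * `|PF x| + KM * Kp * t)).
  rewrite (le_trans (ler_normB _ _))// lerD//.
  rewrite (le_trans (ler_normB _ _))// lerD//.
  rewrite (le_trans (ler_normD _ _))// lerD//.
  by rewrite (le_trans (ler_normD _ _))// lerD.
have C1 : KD <= C.
  by rewrite /C -!addrA lerDl !addr_ge0 ?mulr_ge0 ?sqr_ge0.
have C2 : KM * KD <= C.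
  by rewrite /C [KD + _]addrC -!addrA lerDl !addr_ge0 ?mulr_ge0 ?sqr_ge0.
have C3 : Kp * KF ^+ 2 + KJ * KE * K * k2 + KM * Kp <= C.
  by rewrite /C -!addrA [leRHS]addrA lerDr addr_ge0// mulr_ge0.
clearbody C.
have p1 := ler_wpM2r (normr_ge0 (PF (f x))) C1.
have p2 := ler_wpM2r (normr_ge0 (PF x)) C2.
have p3 := ler_wpM2r t0 C3.
rewrite !mulrDl in p3; rewrite !mulrDr; lra.
Qed.

Lemma sum_sqr3 (I : finType) (e a b c : I -> R) (C : R) : 0 <= C ->
  (forall i, 0 <= e i <= C * (a i + b i + c i)) ->
  \sum_i e i ^+ 2 <= 3 * C ^+ 2 *
     (\sum_i a i ^+ 2 + \sum_i b i ^+ 2 + \sum_i c i ^+ 2).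
Proof.
move=> C0 eC; rewrite -!big_split /= mulr_sumr; apply: ler_sum => i _.
have /andP[e0 ei] := eC i.
apply: (@le_trans _ _ ((C * (a i + b i + c i)) ^+ 2)).
  by rewrite ler_pXn2r ?nnegrE// (le_trans e0).
rewrite exprMn -[leRHS]mulrA [leRHS]mulrCA ler_wpM2l ?sqr_ge0//.
have := sqr_ge0 (a i - b i); have := sqr_ge0 (a i - c i); have := sqr_ge0 (b i - c i).
lra.
Qed.

Lemma euclid_norm_cols d m (M : 'M[R]_(d, m)) :
  euclid_norm M ^+ 2 <= d%:R * \sum_j `|col j M| ^+ 2.
Proof.
rewrite euclid_norm_sqr; rewrite -[d in d%:R]card_ord mulr_natl -sumr_const.
apply: ler_sum => i _; apply: ler_sum => j _.
rewrite -[leLHS]real_normK ?num_real// ler_pXn2r ?nnegrE//.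
by have := le_mx_norm (col j M) i 0; rewrite mxE.
Qed.

Lemma euclid_norm_ge_cols d m (M : 'M[R]_(d, m)) :
  \sum_j `|col j M| ^+ 2 <= euclid_norm M ^+ 2.
Proof.
rewrite euclid_norm_sqr exchange_big /=; apply: ler_sum => j _.
set S := \sum_(i < d) _.
have S0 : 0 <= S by apply: sumr_ge0 => i _; exact: sqr_ge0.
rewrite -[leRHS]sqr_sqrtr// ler_pXn2r ?nnegrE ?sqrtr_ge0//.
apply: mx_norm_le => [|i k]; first exact: sqrtr_ge0.
rewrite mxE -sqrtr_sqr ler_sqrt// /S (bigD1 i)//= lerDl.
by apply: sumr_ge0 => i' _; exact: sqr_ge0.
Qed.

Lemma data_matrix_col (T : Type) d m (phi : T -> 'cV[R]_d) (X : 'I_m -> T) j :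
  col j (data_matrix phi X) = phi (X j).
Proof. by apply/colP => i; rewrite !mxE. Qed.

Lemma tuple_norm_split (B : normedModType R) d (T : 'cV[R]_d -> B)
    (PE : B -> 'cV[R]_d) (PF : B -> B) m (X : 'I_m -> B) (KT : R) : 0 <= KT ->
  (forall z, `|T z| <= KT * `|z|) -> (forall x, x = T (PE x) + PF x) ->
  tuple_norm X ^+ 2 <=
    2 * KT ^+ 2 * euclid_norm (data_matrix PE X) ^+ 2 + 2 * tuple_norm (PF \o X) ^+ 2.
Proof.
move=> KT0 TK xE; rewrite !tuple_norm_sqr.
apply: (@le_trans _ _ (2 * KT ^+ 2 * \sum_j `|col j (data_matrix PE X)| ^+ 2 +
    2 * \sum_i `|(PF \o X) i| ^+ 2)).
  rewrite !mulr_sumr -big_split /=; apply: ler_sum => j _.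
  rewrite data_matrix_col.
  apply: (@le_trans _ _ ((KT * `|PE (X j)| + `|PF (X j)|) ^+ 2)).
    rewrite ler_pXn2r ?nnegrE ?addr_ge0 ?mulr_ge0// {1}(xE (X j)).
    by rewrite (le_trans (ler_normD _ _))// lerD2r.
  have := sqr_ge0 (KT * `|PE (X j)| - `|PF (X j)|); rewrite sqrrB sqrrD exprMn; lra.
rewrite lerD2r ler_wpM2l ?mulr_ge0 ?sqr_ge0//.
exact: euclid_norm_ge_cols.
Qed.

End Data.

Section Estimate.
Context {R : realType}.

Lemma dmd_estimate (B : normedModType R) (f : B -> B) (d : nat)
    (T : 'cV[R]_d -> B) (PE : B -> 'cV[R]_d) (PF : B -> B) (phi : B -> 'cV[R]_d)
    (M0 : 'M[R]_d) (alpha beta KT C r : R) :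
  0 < beta -> beta <= alpha -> 0 <= KT -> (forall z, `|T z| <= KT * `|z|) ->
  (forall x, x = T (PE x) + PF x) -> 0 <= C -> 0 < r ->
  (forall x, `|x| < r -> `|phi (f x) - M0 *m phi x| <=
     C * (`|PF x| + `|PF (f x)| + `|x| `^ alpha * `|x|)) ->
  forall kappa : R, exists C delta : R, 0 < delta /\
    forall (m : nat) (X : 'I_m -> B),
      let Phi := data_matrix phi X in
      let Phihat := data_matrix phi (f \o X) in
      let PEX := euclid_norm (data_matrix PE X) in
      \rank Phi = d ->
      tuple_norm (PF \o X) <= PEX `^ (1 + beta) ->
      tuple_norm (PF \o (f \o X)) <= PEX `^ (1 + beta) ->
      PEX * euclid_norm (pseudo_inverse Phi) <= kappa ->
      PEX < delta ->
      euclid_norm (dmd Phi Phihat - M0) <= C * PEX `^ beta.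
Proof.
move=> be0 beal KT0 TK xE C0 r0 est kappa.
have al0 : 0 < alpha by exact: lt_le_trans beal.
(* [C1 ^+ 2 >= 2 * KT ^+ 2 + 2], so [tuple_norm_split] and [Q <= P] yield [S <= C1 * P]. *)
pose C1 := 2 * (KT + 1); have C10 : 0 < C1 by rewrite /C1; lra.
(* [d] passes from the maximum norm of columns to the Euclidean norm, and 3 comes from squaring a
   sum of three terms. In the last factor, 2 counts the two [PF] tuples and the square belongs to
   the terms of order [1 + alpha]. *)
pose Y := d%:R * (3 * C ^+ 2 * (2 + (C1 `^ alpha * C1) ^+ 2)).
have Y0 : 0 <= Y by rewrite /Y !mulr_ge0 ?addr_ge0 ?sqr_ge0.
(* [Y + 1] exceeds the square root of [Y]. The bound 1 on [PEX] orders its powers, and [r / C1] puts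
   all data in the ball of radius [r]. *)
exists ((Y + 1) * kappa), (Num.min 1 (r / C1)); split.
  by rewrite lt_min ltr01 divr_gt0.
move=> m X Phi Phihat P rPhi FX FfX Pk; rewrite lt_min => /andP[P1 Pr].
have fPhi : row_free Phi by rewrite /row_free rPhi.
have P0 : 0 <= P by exact: euclid_norm_ge0.
have QE : P `^ (1 + beta) = P * P `^ beta.
  by rewrite powRD ?powRr1// gt_eqF// addr_gt0.
have Pab : P `^ alpha <= P `^ beta.
  have [P00|P00] := eqVneq P 0; first by rewrite P00 !powR0 ?gt_eqF.
  by apply: ger_powR => //; rewrite lt_neqAle eq_sym P00 P0 ltW.
have Pb1 : P `^ beta <= 1.
  have := @ge0_ler_powR R beta (ltW be0) P 1.
  by rewrite !nnegrE P0 ler01 powR1 => /(_ isT isT (ltW P1)).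
set Q := P `^ (1 + beta) in QE FX FfX.
have Q0 : 0 <= Q by exact: powR_ge0.
have QP : Q <= P by rewrite QE ler_piMr.
set S := tuple_norm X; have S0 : 0 <= S by exact: tuple_norm_ge0.
have F2 : tuple_norm (PF \o X) ^+ 2 <= Q ^+ 2.
  by rewrite ler_pXn2r ?nnegrE ?tuple_norm_ge0.
have Ff2 : tuple_norm (PF \o (f \o X)) ^+ 2 <= Q ^+ 2.
  by rewrite ler_pXn2r ?nnegrE ?tuple_norm_ge0.
have C1P : 0 <= C1 * P by rewrite mulr_ge0// ltW.
have SC : S <= C1 * P.
  rewrite -(ler_pXn2r (ltn0Sn 1)) ?nnegrE//.
  have := tuple_norm_split X KT0 TK xE; rewrite -/S -/P => H.
  have Q2 : Q ^+ 2 <= P ^+ 2 by rewrite ler_pXn2r ?nnegrE.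
  have E : (C1 * P) ^+ 2 = 2 * KT ^+ 2 * P ^+ 2 + 2 * P ^+ 2 + 2 * KT ^+ 2 * P ^+ 2
      + 8 * KT * P ^+ 2 + 2 * P ^+ 2 by rewrite /C1; ring.
  have p1 : 0 <= KT ^+ 2 * P ^+ 2 by rewrite mulr_ge0 ?sqr_ge0.
  have p2 : 0 <= KT * P ^+ 2 by rewrite mulr_ge0 ?sqr_ge0.
  have p3 := sqr_ge0 P.
  rewrite E; lra.
clearbody C1; have Sr : S < r.
  by rewrite (le_lt_trans SC)// mulrC -ltr_pdivlMr.
have SQ : S `^ alpha * S <= C1 `^ alpha * C1 * Q.
  have H1 : S `^ alpha <= C1 `^ alpha * P `^ alpha.
    rewrite -powRM ?(ltW C10)//.
    by apply: ge0_ler_powR; rewrite ?nnegrE ?(ltW al0).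
  have H2 : S `^ alpha <= C1 `^ alpha * P `^ beta.
    by rewrite (le_trans H1)// ler_wpM2l// powR_ge0.
  rewrite (le_trans (ler_pM _ _ H2 SC)) ?powR_ge0// QE.
  by rewrite le_eqVlt; apply/orP; left; apply/eqP; ring.
have R2 : euclid_norm (Phihat - M0 *m Phi) ^+ 2 <= Y * Q ^+ 2.
  rewrite (le_trans (euclid_norm_cols _))// /Y -mulrA ler_wpM2l//.
  apply: (@le_trans _ _ (3 * C ^+ 2 * (\sum_j `|(PF \o X) j| ^+ 2 +
      \sum_j `|(PF \o (f \o X)) j| ^+ 2 + \sum_j (S `^ alpha * `|X j|) ^+ 2))).
    apply: sum_sqr3 => // j; rewrite normr_ge0 /=.
    have -> : col j (Phihat - M0 *m Phi) = phi (f (X j)) - M0 *m phi (X j).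
      by rewrite linearB/= !colE -mulmxA -!colE !data_matrix_col.
    have xS : `|X j| <= S by exact: le_tuple_norm.
    rewrite (le_trans (est _ (le_lt_trans xS Sr)))// ler_wpM2l// lerD2l.
    apply: ler_wpM2r; first exact: normr_ge0.
    by apply: (ge0_ler_powR (ltW al0)); rewrite ?nnegrE.
  rewrite -[leRHS]mulrA ler_wpM2l ?mulr_ge0 ?sqr_ge0// -!tuple_norm_sqr.
  under eq_bigr do rewrite exprMn.
  rewrite -mulr_sumr -tuple_norm_sqr -exprMn mulrDl -exprMn.
  apply: lerD; first by rewrite mulr2n mulrDl mul1r lerD.
  by rewrite -/S ler_pXn2r ?nnegrE ?mulr_ge0 ?powR_ge0 ?(ltW C10).
have RQ : euclid_norm (Phihat - M0 *m Phi) <= (Y + 1) * Q.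
  rewrite -(ler_pXn2r (ltn0Sn 1)) ?nnegrE ?euclid_norm_ge0 ?mulr_ge0 ?addr_ge0//.
  rewrite (le_trans R2)// exprMn ler_wpM2r ?sqr_ge0//.
  by have := sqr_ge0 Y; lra.
rewrite dmd_sub// (le_trans (euclid_norm_mulmx _ _))//.
rewrite (le_trans (ler_wpM2r (euclid_norm_ge0 _) RQ))// QE.
have -> : (Y + 1) * (P * P `^ beta) * euclid_norm (pseudo_inverse Phi) =
  (Y + 1) * P `^ beta * (P * euclid_norm (pseudo_inverse Phi)) by ring.
by rewrite [leRHS]mulrAC ler_wpM2l// mulr_ge0 ?powR_ge0// addr_ge0.
Qed.

Lemma linear_top_conjugate d (LE J : 'M[R]_d) : J \in unitmx ->
  locally_top_conjugate (mulmx (J *m LE *m invmx J)) (mulmx LE).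
Proof.
move=> uJ; have cM (M : 'M[R]_d) z : {for z, continuous (mulmx M : 'cV[R]_d -> _)}.
  apply: strict_diff_for_continuous.
  exact/strict_diff_linear/linear_cV_bounded.
exists setT, (mulmx (invmx J)), (mulmx J); split.
- by split; [exact: openT|].
- split; last by rewrite mulmx0.
  suff -> : mulmx (invmx J) @` setT = (setT : set 'cV[R]_d) by exact: openT.
  by apply/seteqP; split => // z _; exists (J *m z) => //; rewrite mulKmx.
- by move=> z _; rewrite mulKVmx.
- by split => z _; exact: cM.
- by move=> z _ _; rewrite -!mulmxA mulKmx.
Qed.

End Estimate.

Theorem theorem3 (R : realType) (B : completeNormedModType R) (U : set B)
    (A Ainv : {linear B -> B}) (ft : B -> B) (alpha beta : R) (d : nat)
    (E F : set B) (TE : {linear 'cV[R]_d -> B}) (LE : 'M[R]_d)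
    (PE : B -> 'cV[R]_d) (PF : B -> B) (phi : B -> 'cV[R]_d) :
  let f := fun x : B => A x + ft x in
  let J := observable_jacobian phi TE in
  let M0 := J *m LE *m invmx J in
  (* setting *)
  open U -> U 0 ->
  continuous A -> continuous Ainv -> cancel A Ainv -> cancel Ainv A ->
  ft 0 = 0 -> (forall v : B, 'd ft (0 : B) v = 0) ->
  (* (A1) *)
  0 < alpha < 1 -> alpha_contracting alpha A Ainv ->
  (* (A2) *)
  C1_holder_on alpha U ft ->
  (* (A3) *)
  (0 < d)%N -> is_direct_sum E F -> closed F ->
  invariant_under A E -> invariant_under A F ->
  real_eigenbasis_iso A E TE -> (forall z, A (TE z) = TE (LE *m z)) ->
  splitting_projections F TE PE PF ->
  spectral_radius_on F A < (spectral_radius_on E Ainv)^-1 ->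
  C2_on U phi -> phi 0 = 0 -> \rank J = d ->
  (* exponent in (A4) *)
  0 < beta < 1 -> beta <= alpha ->
  (* the spectral submanifold and the linearized dynamics on it *)
  (exists (W : set B) (Omega : set 'cV[R]_d) (w : 'cV[R]_d -> B)
      (r : 'cV[R]_d -> 'cV[R]_d),
    [/\ attracting_ssm U f E W Omega w r,
        (forall z, 'd w (0 : 'cV[R]_d) z = TE z) /\
        (forall z, 'd r (0 : 'cV[R]_d) z = LE *m z),
        locally_top_conjugate r ('d r (0 : 'cV[R]_d))
      & locally_top_conjugate (mulmx M0) ('d r (0 : 'cV[R]_d))])
  /\
  (* D = M0 + O(|PE X|^beta); the constants depend on the data only through a
     bound kappa on the degeneracy of Phi *)
  (forall kappa : R, exists C delta : R, 0 < delta /\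
    forall (m : nat) (X : 'I_m -> B),
      let Phi := data_matrix phi X in
      let Phihat := data_matrix phi (f \o X) in
      let PEX := euclid_norm (data_matrix PE X) in
      (forall i, U (X i)) ->
      (* (A4) *)
      \rank Phi = d ->
      tuple_norm (PF \o X) <= PEX `^ (1 + beta) ->
      tuple_norm (PF \o (f \o X)) <= PEX `^ (1 + beta) ->
      PEX * euclid_norm (pseudo_inverse Phi) <= kappa ->
      PEX < delta ->
      euclid_norm (dmd Phi Phihat - M0) <= C * PEX `^ beta).
Proof.
move=> f J M0 oU U0 cA cAi AK AiK ft0 dft0 al01 cAA ftH d0 dEF cF _ iF [injT rT _] AT
  sP _ phi2 phi0 rJ /andP[be0 _] beal.
have [al0 _] := andP al01.
have [bPE _ PET _ PEF] := splitting_projections_bounded dEF cF injT rT sP.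
split.
  have [W [ Omega [w [ssm dw]]]] := spectral_submanifold oU U0 cA cAi AK AiK ft0 dft0
    al0 cAA ftH d0 dEF cF injT rT AT sP.
  have [_ dr] := strict_diff_differentiable
    (strict_diff_linear 0 (linear_cV_bounded (mulmx LE : {linear 'cV_d -> 'cV_d}))).
  exists W, Omega, w, (mulmx LE); rewrite dr; split => //.
    (* The reduced dynamics is already linear, so its conjugacy to its derivative is the case
       [J = 1]. *)
    have := linear_top_conjugate LE (unitmx1 R d).
    by rewrite mul1mx invmx1 mulmx1.
  by apply: linear_top_conjugate; rewrite -row_free_unit /row_free rJ.
have [C [r [C0 r0 est]]] := observable_estimate oU U0 cA ft0 dft0 al01 ftH iF AT sP
  bPE PET PEF phi2 phi0 rJ.
have [_ [KT KT0 TK]] := linear_cV_bounded TE.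
move=> kappa; have [C' [delta [delta0 H]]] := dmd_estimate be0 beal KT0 TK
  (fun x => (sP x).2) C0 r0 est kappa.
by exists C', delta; split => // m X Phi Phihat PEX _; exact: H.
Qed.
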